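(* Assume the following conjecture holds: for every polynomial $P\in\mathbb{Z}[X_1,\dots,X_n]$ of total degree at least $2$, one has $N_P(B)\sim \mathscr{C}_P B_1\cdots B_n$ as $\min_{1\leq j\leq n}B_j\to\infty$. Let $g\geq 5$ be an integer and $H_3=\mathbb{Z}/g\mathbb{Z}\times\mathbb{Z}/g\mathbb{Z}$. Then for every $\epsilon>0$ and all sufficiently large $X$, \[ N_{H_3}(X)=\#\{d\leq X:\ H_3\hookrightarrow \mathrm{Cl}(-d)\}\gg X^{\frac{1}{g-1}-\epsilon}. \]
   Context: Throughout, $d>1$ denotes a square-free positive integer, and $\mathrm{Cl}(-d)$ is the ideal class group of $\mathbb{Q}(\sqrt{-d})$. For a finite abelian group $H$ and $X>0$, $N_H(X)$ is the number of square-free integers $1<d\leq X$ admitting an injective homomorphism $H\hookrightarrow\mathrm{Cl}(-d)$. For $P\in\mathbb{Z}[X_1,\dots,X_n]$ and an integer $m>1$, let $\rho_P(m)=\#\{X\in(\mathbb{Z}/m\mathbb{Z})^n: P(X)\equiv 0 \bmod m\}$ and $\mathscr{C}_P=\prod_{p\text{ prime}}\bigl(1-\rho_P(p^2)/p^{2n}\bigr)$. For real numbers $B_1,\dots,B_n\geq 1$, let $B=\prod_{j=1}^n[0,B_j]\cap\mathbb{Z}^n$, $r_P(h)=\#\{X\in B: P(X)=h\}$ for $h\in\mathbb{Z}$, and $N_P(B)=\sum_{h\in\mathbb{Z},\,h\neq 0}\mu(|h|)^2 r_P(h)$, i.e. the number of $X\in B$ with $P(X)$ a nonzero square-free integer ($\mu$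 is the Möbius function). The notation $f\gg g$ means $f\geq c\,g$ for some constant $c>0$ (depending on $g$ and $\epsilon$) for all large $X$; $f\sim g$ means $f/g\to 1$. *)

(* Defs.v *)
From HB Require Import structures.
From mathcomp Require Import all_boot all_order all_algebra all_field.
From mathcomp Require Import all_classical all_reals all_analysis.
(* The notations of mpoly clash with those of the analysis library. *)
From mathcomp Require mpoly.
Import (canonicals, coercions) mpoly.

Set Implicit Arguments.
Unset Strict Implicit.
Unset Printing Implicit Defensive.

Import Order.TTheory GRing.Theory Num.Theory.
Import numFieldNormedType.Exports.

Local Open Scope classical_set_scope.
Local Open Scope ring_scope.

(* [0] is not square-free: take [k = 0]. *)
Definition squarefree (m : nat) : bool :=
  [forall k : 'I_m.+1, ((k ^ 2)%N %| m)%N ==> (k == 1%N :> nat)].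

(** * The ideal class group of Q(sqrt(-d)) *)

(* The quadratic field is realized inside [algC], and its ring of integers is
   the set of its elements that are algebraic integers. *)
Definition quad_field (d : nat) : set algC :=
  [set x | exists a b : rat, x = ratr a + ratr b * sqrtC (- d%:R)].

Definition quad_int (d : nat) : set algC :=
  [set x | quad_field d x /\ x \in Aint].

Definition frac_ideal (d : nat) (I : set algC) : Prop :=
  [/\ I `<=` quad_field d,
      forall x y, I x -> I y -> I (x - y),
      forall a x, quad_int d a -> I x -> I (a * x),
      exists2 x, I x & x != 0
    & exists2 a, quad_int d a & a != 0 /\ forall x, I x -> quad_int d (a * x)].

Definition ideal_mul (I J : set algC) : set algC :=
  [set z | exists2 s : seq (algC * algC),
     (forall u, u \in s -> I u.1 /\ J u.2) & z = \sum_(u <- s) u.1 * u.2].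

Definition ideal_equiv (d : nat) (I J : set algC) : Prop :=
  exists2 a, quad_field d a & a != 0 /\ J = [set a * x | x in I].

Definition ideal_class (d : nat) (I : set algC) : set (set algC) :=
  [set J | frac_ideal d J /\ ideal_equiv d I J].

(* [Cl d] is the set of elements of Cl(-d): an element is a class of fractional
   ideals modulo multiplication by nonzero principal ones. *)
Definition Cl (d : nat) : set (set (set algC)) :=
  [set C | exists2 I, frac_ideal d I & C = ideal_class d I].

(* The group law of [Cl d]: the class of the products of representatives. *)
Definition Cl_mul (d : nat) (C D : set (set algC)) : set (set algC) :=
  [set L | frac_ideal d L /\
     exists I J, [/\ C I, D J & ideal_equiv d (ideal_mul I J) L]].

(* [H] is written additively, [Cl d] multiplicatively. *)
Definition embeds_in_Cl (H : zmodType) (d : nat) : Prop :=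
  exists f : H -> set (set algC),
    [/\ forall x, Cl d (f x),
        forall x y, f (x + y) = Cl_mul d (f x) (f y)
      & injective f].

Definition N_H (R : realType) (H : zmodType) (X : R) : nat :=
  #|[pred d : 'I_(Num.truncn X).+1 |
      [&& (1 < d)%N, squarefree d & `[< embeds_in_Cl H d >]]]|.

(** * Square-free values of integer polynomials *)

(* Meaningful for [m > 1] only, where ['Z_m] is the ring Z/mZ. *)
Definition rho (n : nat) (P : mpoly.mpoly n int) (m : nat) : nat :=
  #|[pred x : {ffun 'I_n -> 'Z_m} |
      mpoly.meval x (mpoly.map_mpoly (fun z : int => z%:~R : 'Z_m) P) == 0]|.

(* The factors lie in [0, 1], so the partial products are nonincreasing and the
   limit exists. *)
Definition sqf_constant (R : realType) (n : nat) (P : mpoly.mpoly n int) : R :=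
  limn (fun N : nat =>
    \prod_(p < N | prime p) (1 - (rho P (p ^ 2)%N)%:R / p%:R ^+ (2 * n)) : R).

(* The integer points of the box are the tuples of [x j <= truncn (B j)]. *)
Definition sqf_count (R : realType) (n : nat) (P : mpoly.mpoly n int)
    (B : 'I_n -> R) : nat :=
  #|[pred x : {dffun forall j : 'I_n, 'I_(Num.truncn (B j)).+1} |
      squarefree `|mpoly.meval (fun j => (x j : nat)%:Z) P|%N]|.

(* The total degree of [P] is [(msize P).-1].  The asymptotic equivalence, a
   quotient tending to 1, only makes sense when the main term does not vanish.
   Without this proviso the conjecture would be false: for P = X^2 the constant
   is the product of the 1 - 1/p, that is 0, whereas there is always exactly one
   square-free value. *)
Definition sqf_values_conjecture (R : realType) : Prop :=
  forall (n : nat) (P : mpoly.mpoly n int),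
    (2 <= (mpoly.msize P).-1)%N ->
    sqf_constant R P != 0 ->
    forall e : R, 0 < e ->
    exists M : R, forall B : 'I_n -> R,
      (forall j, 1 <= B j) -> (forall j, M <= B j) ->
      `| (sqf_count P B)%:R / (sqf_constant R P * \prod_j B j) - 1 | < e.

(* Main.v *)
(* Put [sg = (2 s)^g] and [Q = ((b + k)^g - b^g) / k].  Then
     [4 b^g sg - (k sg - Q)^2 = 4 (b + k)^g sg - (k sg + Q)^2],
   and we let [d] be this common value.  When [d] is squarefree, the two
   expressions make [(k sg -+ Q + sqrt(-d)) / 2] the generators of the [g]-th
   powers of two ideals, of norms [z2 = 2 s b] and [z1 = 2 s (b + k)].
   If [d] is of the order of [z1^g] and of [z2^g], a nontrivial product of powers
   of the two ideals with exponents at most [g / 2] in absolute value has too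
   small a norm to be principal, except that the product of the two powers of
   exponent [g / 2] has to be excluded modulo 4; hence (Z/g)^2 embeds in Cl(-d).

   The constant of the three-variable polynomial [d] is positive: it takes the
   value -1, and for fixed [b] and [k] its discriminant in [sg] is [16 (b (b + k))^g],
   so that it has [O(p^4)] zeros modulo [p^2].  On the box [b ~ t^g], [k ~ t^g],
   [s ~ t^(g-2)], where [d] has size [t^(2g(g-1))], the conjecture therefore gives
   about [t^(3g-2)] triples with [d] squarefree.  Two triples with the same [d] satisfy
   [(x - x') (x + x') = 4 (z2^g - z2'^g)], where [x = k sg - Q]; the divisor bound leaves
   at most [t^(4(g-1)+o(1))] such pairs, and by Cauchy-Schwarz there are at least
   [t^(2g-o(1))] different values of [d]. *)
Require Import Defs.
From mathcomp Require Import all_boot all_order all_algebra all_field.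
From mathcomp Require Import all_classical all_reals all_analysis.
From mathcomp Require Import ring lra zify.
From mathcomp Require mpoly.
Import (canonicals, coercions) mpoly.
Import Order.TTheory GRing.Theory Num.Theory.
Import numFieldNormedType.Exports.

Set Implicit Arguments.
Unset Strict Implicit.
Unset Printing Implicit Defensive.

(** * Divisors and collisions *)

(** It is [2 s], and not [s], that is raised to the power [g], so that the two traces [k sg + Q] and
    [k sg - Q] add up to a multiple of 8; the parity argument for the two powers of exponent [g / 2]
    depends on it. Two inequalities shape the counting: [sg >= 4 g^2 b^(g-2)] and [k^2 sg <= b^g].
    They bound the squares of [Q] and of [k sg] by [b^g sg], so that [d] keeps three quarters of its
    main term, and they make the trace strictly increasing in [k], so that [b], [s] and the trace
    determine the triple. Once [b] has order [t^g], the first one forces [s] to have order at least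
    [t^(g-2)], and with this [s] the second one leaves room for [k] up to order [t^g]: hence the
    shape of the box. Since [d] is then of order [t^(2g(g-1))], the [t^(2g)] values of [d] produce
    the exponent [1/(g-1)]. The loss of [eps] comes from the divisor bound alone. *)

Lemma size_divisors_pfactor (p n : nat) : prime p -> 0 < n ->
  size (divisors n) <= (logn p n).+1 * size (divisors n`_p^').
Proof.
move=> pp n0.
have -> : (logn p n).+1 * size (divisors n`_p^') =
    size [seq p ^ i * e | i <- iota 0 (logn p n).+1, e <- divisors n`_p^'].
  by rewrite size_allpairs size_iota.
apply: uniq_leq_size; first exact: divisors_uniq.
move=> x; rewrite -dvdn_divisors// => xn.
have x0 : 0 < x by exact: dvdn_gt0 xn.
apply/allpairsP; exists (logn p x, x`_p^'); split.
- by rewrite mem_iota add0n ltnS dvdn_leq_log.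
- by rewrite -dvdn_divisors ?part_gt0// partn_dvd.
- by rewrite -p_part partnC.
Qed.

(** Bounding [e + 1] by [k * 2 ^ (e %/ k)] before taking the power [k] produces the factor [k ^ k],
    the price of one small prime in the divisor bound. *)
Lemma succ_expn_le (k e : nat) : 0 < k -> e.+1 ^ k <= k ^ k * 2 ^ e.
Proof.
move=> k0.
have h1 : e.+1 <= k * 2 ^ (e %/ k).
  apply: (@leq_trans (k * (e %/ k).+1)); last by rewrite leq_mul2l ltn_expl// orbT.
  by rewrite mulnC ltn_ceil.
apply: (@leq_trans ((k * 2 ^ (e %/ k)) ^ k)); first by rewrite leq_exp2r.
by rewrite expnMn leq_mul2l -expnM leq_exp2l// leq_trunc_div orbT.
Qed.

(** A prime [p] of exponent [e] contributes [(e + 1) ^ k] on the left and [p ^ e] on the right. If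
    [p >= 2 ^ k] the right side wins, because [e + 1 <= 2 ^ e]; a smaller prime costs at most
    [k ^ k], and there are at most [2 ^ k] of these. *)
Lemma divisor_bound (k : nat) : 0 < k ->
  exists2 C, 0 < C & forall n, 0 < n -> size (divisors n) ^ k <= C * n.
Proof.
move=> k0; pose c := k ^ k.
have c0 : 0 < c by rewrite expn_gt0 k0.
exists (c ^ 2 ^ k); first by rewrite expn_gt0 c0.
(* Induction on a strict bound [B] for the prime factors: the passage to [B.+1] splits off the
   [B]-part of [n]. The exponent [minn B (2 ^ k)] bounds the number of small primes met so far. *)
have key B n : 0 < n -> (forall q, prime q -> q %| n -> q < B) ->
    size (divisors n) ^ k <= c ^ minn B (2 ^ k) * n.
  elim: B n => [|B IH] n n0 nB.
    have -> : n = 1.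
      by apply/eqP; rewrite eqn_leq n0 andbT leqNgt; apply/negP => /pdivP[q qp /(nB _ qp)].
    by rewrite min0n expn0 exp1n.
  have [Bp|Bp] := boolP (prime B); last first.
    apply: leq_trans (IH n n0 _) _.
      move=> q qp qn; have := nB q qp qn; rewrite ltnS leq_eqVlt => /orP[/eqP qB|//].
      by rewrite -qB qp in Bp.
    by rewrite leq_mul2r leq_pexp2l ?orbT// leq_min geq_minr andbT (leq_trans (geq_minl _ _)).
  have m0 : 0 < n`_B^' by exact: part_gt0.
  have mB q : prime q -> q %| n`_B^' -> q < B.
    move=> qp qm; have := nB q qp (dvdn_trans qm (dvdn_part _ _)).
    rewrite ltnS leq_eqVlt => /orP[/eqP qB|//]; exfalso.
    have : q \in \pi(n`_B^') by rewrite mem_primes qp m0 qm.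
    by move/(pnatPpi (part_pnat _ _)); rewrite qB !inE eqxx.
  apply: (@leq_trans (((logn B n).+1 * size (divisors n`_B^')) ^ k)).
    by rewrite leq_exp2r// size_divisors_pfactor.
  rewrite expnMn.
  apply: (@leq_trans ((c ^ (B < 2 ^ k) * B ^ logn B n) * (c ^ minn B (2 ^ k) * n`_B^'))).
    apply: leq_mul; last exact: IH.
    case: ltnP => h; rewrite ?expn1 ?expn0 ?mul1n.
      apply: leq_trans (succ_expn_le _ k0) _; rewrite leq_mul2l; apply/orP; right.
      by case: (logn B n) => // e; rewrite leq_exp2r// prime_gt1.
    apply: (@leq_trans ((2 ^ logn B n) ^ k)); first by rewrite leq_exp2r// ltn_expl.
    by rewrite -expnM mulnC expnM; case: (logn B n) => // e; rewrite leq_exp2r.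
  rewrite mulnACA -expnD -p_part partnC// leq_mul2r; apply/orP; right.
  by rewrite leq_pexp2l//; move: (2 ^ k) => m; clear; lia.
move=> n n0; apply: leq_trans (key n.+1 n n0 _) _.
  by move=> q qp qn; rewrite ltnS dvdn_leq.
by rewrite leq_mul2r leq_pexp2l ?geq_minr ?orbT.
Qed.

(** Cauchy-Schwarz for the fibre sizes [r u]: they sum to the size of [A], and the colliding pairs
    number the sum of their squares. *)
Lemma card_image_pairs (T U : finType) (A : {set T}) (f : T -> U) :
  #|A| ^ 2 <= #|f @: A| * #|[set t : T * T | [&& t.1 \in A, t.2 \in A & f t.1 == f t.2]]|.
Proof.
pose r u := #|[set x in A | f x == u]|.
have cA : #|A| = \sum_(u in f @: A) r u.
  rewrite -sum1_card (partition_big f (mem (f @: A))) => [|x xA]; last exact: imset_f.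
  by apply: eq_bigr => u _; rewrite /r -sum1_card; apply: eq_bigl => x; rewrite !inE.
have cE : #|[set t : T * T | [&& t.1 \in A, t.2 \in A & f t.1 == f t.2]]| =
    \sum_(u in f @: A) r u ^ 2.
  rewrite -sum1_card (partition_big (fun t => f t.1) (mem (f @: A))); last first.
    by move=> t; rewrite !inE => /and3P[tA _ _]; exact: imset_f.
  apply: eq_bigr => u _; rewrite -mulnn /r -cardsX -sum1_card; apply: eq_bigl => -[x y].
  rewrite !inE /=; case: (x \in A); rewrite ?andbF//=; case: (y \in A); rewrite ?andbF//=.
  by rewrite andbC; case: eqP => //= ->; rewrite eq_sym.
rewrite cA cE; set D := f @: A.
rewrite -(leq_pmul2l (m := 2))//.
have -> : 2 * (\sum_(u in D) r u) ^ 2 = \sum_(u in D) \sum_(v in D) 2 * (r u * r v).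
  rewrite -mulnn big_distrl /= big_distrr /=; apply: eq_bigr => u _.
  by rewrite big_distrr big_distrr.
apply: (@leq_trans (\sum_(u in D) \sum_(v in D) (r u ^ 2 + r v ^ 2))).
  by apply: leq_sum => u _; apply: leq_sum => v _; exact: nat_Cauchy.
under eq_bigr => u _ do rewrite big_split /= sum_nat_const.
by rewrite big_split /= sum_nat_const -big_distrr /= mul2n addnn.
Qed.

Local Open Scope ring_scope.

(** * Quadratic fields and ideals cut out by roots *)

Lemma Aint_expr_inv (n : nat) (x : algC) : (0 < n)%N -> x ^+ n \in Aint -> x \in Aint.
Proof.
move=> n0 xA; apply: (@root_monic_Aint (minCpoly (x ^+ n) \Po 'X^n)).
- by rewrite /root horner_comp hornerXn -/(root _ _) root_minCpoly.
- rewrite monicE lead_coef_comp ?size_polyXn// lead_coefXn expr1n mulr1 -monicE.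
  exact: minCpoly_monic.
- by rewrite polyOver_comp// rpredX// polyOverX.
Qed.

Lemma squarefree_gt0 (m : nat) : squarefree m -> (0 < m)%N.
Proof. by case: m => // /forallP /(_ ord0). Qed.

Lemma squarefree_sqr_dvd (m k : nat) : squarefree m -> (k ^ 2 %| m)%N -> k = 1%N.
Proof.
move=> sm km; have m0 := squarefree_gt0 sm.
have kle : (k < m.+1)%N.
  rewrite ltnS; apply: leq_trans (dvdn_leq m0 km); case: k {km} => // k.
  by rewrite expnS leq_pmulr // expn_gt0.
by move/forallP: sm => /(_ (Ordinal kle)) /=; rewrite km => /eqP.
Qed.

Lemma squarefree_mul_sqr_int (m : nat) (w : rat) :
  squarefree m -> m%:R * w ^+ 2 \is a Num.int -> w \is a Num.int.
Proof.
move=> sm /intrP[e eE].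
have den0 : (denq w)%:~R != 0 :> rat by rewrite intr_eq0 denq_neq0.
have : (m%:Z * numq w ^+ 2)%:~R = (e * denq w ^+ 2)%:~R :> rat.
  by rewrite !expr2 !intrM -eE -{3}(divq_num_den w); field.
move/intr_inj/(congr1 absz); rewrite !expr2 !abszM absz_nat !mulnn => h.
have : (`|denq w| ^ 2 %| m * `|numq w| ^ 2)%N by rewrite h dvdn_mull.
rewrite Gauss_dvdl; last by rewrite coprimeXl// coprimeXr// coprime_sym coprime_num_den.
move/(squarefree_sqr_dvd sm) => d1.
by rewrite -(divq_num_den w) -[denq w]gez0_abs ?denq_ge0// d1 divr1 intr_int.
Qed.

Section QuadraticField.
Variable d : nat.
Hypothesis sqf_d : squarefree d.

Let d_gt0 : (0 < d)%N := squarefree_gt0 sqf_d.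

Notation r := (sqrtC (- d%:R) : algC).
Notation K := (quad_field d).

Lemma sqr_sqrtCN : r ^+ 2 = - d%:R. Proof. exact: sqrtCK. Qed.

Lemma sqrtCN_neq0 : r != 0.
Proof. by rewrite sqrtC_eq0 oppr_eq0 pnatr_eq0 -lt0n. Qed.

Lemma conj_sqrtCN : r^* = - r.
Proof.
have /eqP : (r^*) ^+ 2 = r ^+ 2.
  by rewrite -rmorphXn /= sqr_sqrtCN rmorphN rmorph_nat.
rewrite eqf_sqr => /orP[/eqP/CrealP rR|/eqP//].
have := real_exprn_even_ge0 (n := 2) rR isT.
by rewrite sqr_sqrtCN oppr_ge0 lern0 eqn0Ngt d_gt0.
Qed.

Lemma quad_fieldP (x : algC) :
  K x <-> exists2 a, a \in Crat & exists2 b, b \in Crat & x = a + b * r.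
Proof.
split=> [[a [b ->]]|[a /CratP[a' ->] [b /CratP[b' ->] ->]]].
  by exists (ratr a); [exact: Crat_rat|exists (ratr b); [exact: Crat_rat|]].
by exists a', b'.
Qed.

Lemma quad_field_Crat (x : algC) : x \in Crat -> K x.
Proof.
by move=> Qx; apply/quad_fieldP; exists x => //; exists 0; rewrite ?rpred0// mul0r addr0.
Qed.

Lemma quad_field_int (m : int) : K m%:~R.
Proof. exact/quad_field_Crat/rpred_int. Qed.

Lemma quad_field_sqrtCN : K r.
Proof.
by apply/quad_fieldP; exists 0; rewrite ?rpred0//; exists 1; rewrite ?rpred1// mul1r add0r.
Qed.

Lemma quad_fieldD (x y : algC) : K x -> K y -> K (x + y).
Proof.
move=> /quad_fieldP[a Qa [b Qb ->]] /quad_fieldP[a' Qa' [b' Qb' ->]].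
apply/quad_fieldP; exists (a + a'); first exact: rpredD.
by exists (b + b'); [exact: rpredD|rewrite mulrDl addrACA].
Qed.

Lemma quad_fieldN (x : algC) : K x -> K (- x).
Proof.
move=> /quad_fieldP[a Qa [b Qb ->]]; apply/quad_fieldP; exists (- a); rewrite ?rpredN//.
by exists (- b); rewrite ?rpredN// mulNr opprD.
Qed.

Lemma quad_fieldM (x y : algC) : K x -> K y -> K (x * y).
Proof.
move=> /quad_fieldP[a Qa [b Qb ->]] /quad_fieldP[a' Qa' [b' Qb' ->]].
apply/quad_fieldP; exists (a * a' - d%:R * (b * b')).
  by rewrite rpredB// !rpredM// rpred_nat.
exists (a * b' + a' * b); first by rewrite rpredD// rpredM.
by have := sqr_sqrtCN => h; ring: h.
Qed.

Lemma quad_fieldX (x : algC) n : K x -> K (x ^+ n).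
Proof.
move=> Kx; elim: n => [|n IH]; first by rewrite expr0; exact: (quad_field_int 1).
by rewrite exprS; exact: quad_fieldM.
Qed.

Lemma quad_field_conj (x : algC) : K x -> K x^*.
Proof.
move=> /quad_fieldP[a Qa [b Qb ->]]; apply/quad_fieldP; exists a => //.
exists (- b); first by rewrite rpredN.
by rewrite rmorphD rmorphM /= conj_sqrtCN !conj_Crat// mulrN mulNr.
Qed.

Lemma quad_field_norm (x : algC) : K x -> x * x^* \in Crat.
Proof.
move=> /quad_fieldP[a Qa [b Qb ->]].
rewrite rmorphD rmorphM /= conj_sqrtCN !conj_Crat//.
have -> : (a + b * r) * (a + b * - r) = a ^+ 2 + d%:R * b ^+ 2.
  by have := sqr_sqrtCN => h; ring: h.
by rewrite rpredD// ?rpredM ?rpredX// rpred_nat.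
Qed.

Lemma quad_fieldV (x : algC) : K x -> K x^-1.
Proof.
move=> Kx; have [->|x0] := eqVneq x 0; first by rewrite invr0; exact: (quad_field_int 0).
have -> : x^-1 = x^* * (x * x^*)^-1 by rewrite invfM mulrCA divff ?mulr1// conjC_eq0.
apply: quad_fieldM; first exact: quad_field_conj.
by apply: quad_field_Crat; rewrite rpredV; exact: quad_field_norm.
Qed.

Lemma quad_fieldF (x y : algC) : K x -> K y -> K (x / y).
Proof. by move=> Kx Ky; apply: quad_fieldM => //; exact: quad_fieldV. Qed.

(** The trace [2 a] and the number [d (2 b)^2], up to sign the square of the difference with the
    conjugate, are rational algebraic integers; as [d] is square-free, [2 b] is an integer too.
    Half-integral coordinates cover all residues of [d] modulo 4 at once. *)
Lemma quad_int_coord (a b : algC) : a \in Crat -> b \in Crat ->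
  a + b * r \in Aint -> exists u v : int, [/\ a = u%:~R / 2, b = v%:~R / 2 &
    `|a + b * r| ^+ 2 = (u%:~R ^+ 2 + d%:R * v%:~R ^+ 2) / 4].
Proof.
move=> Qa Qb xA.
have cj : (a + b * r)^* = a - b * r.
  by rewrite rmorphD rmorphM /= conj_sqrtCN !conj_Crat// mulrN.
have cA : a - b * r \in Aint by rewrite -cj Aint_aut.
have uZ : a * 2 \in Num.int.
  apply: Cint_rat_Aint; first by rewrite rpredM// rpred_nat.
  have -> : a * 2 = (a + b * r) + (a - b * r) by ring.
  exact: rpredD.
have vZ : d%:R * (b * 2) ^+ 2 \in Num.int.
  apply: Cint_rat_Aint; first by rewrite rpredM ?rpredX ?rpredM// rpred_nat.
  have -> : d%:R * (b * 2) ^+ 2 = - ((a + b * r) - (a - b * r)) ^+ 2.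
    by have := sqr_sqrtCN => h; ring: h.
  by rewrite rpredN rpredX// rpredB.
have vZ' : b * 2 \in Num.int.
  have Qv : b * 2 \in Crat by rewrite rpredM// rpred_nat.
  case/CratP: Qv vZ => w -> vZ.
  move/intrP: vZ => [e eE].
  have /(squarefree_mul_sqr_int sqf_d)/intrP[f ->] : d%:R * w ^+ 2 \is a Num.int.
    apply/intrP; exists e; apply: (fmorph_inj (@ratr algC)).
    by rewrite rmorphM rmorphXn /= ratr_nat ratr_int.
  by rewrite ratr_int intr_int.
move/intrP: uZ => [u uE]; move/intrP: vZ' => [v vE].
exists u, v; rewrite -uE -vE; split; [by field|by field|].
rewrite normCK cj; have := sqr_sqrtCN => h; by field: h.
Qed.


Lemma quad_coord_inj (a b a' b' : algC) :
  a \in Crat -> b \in Crat -> a' \in Crat -> b' \in Crat ->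
  a + b * r = a' + b' * r -> a = a' /\ b = b'.
Proof.
move=> Qa Qb Qa' Qb' e.
have e' : a - b * r = a' - b' * r.
  have := congr1 (fun t : algC => t^*) e.
  by rewrite !rmorphD !rmorphM /= conj_sqrtCN !conj_Crat// !mulrN.
have two0 : 2 != 0 :> algC by rewrite pnatr_eq0.
have ea : a = a'.
  apply: (mulIf two0); rewrite (_ : a * 2 = (a + b * r) + (a - b * r)); last by ring.
  by rewrite e e'; ring.
by split=> //; apply: (mulIf sqrtCN_neq0); move: e; rewrite ea => /addrI.
Qed.

(** The norms of [w] and of its inverse are positive integers with product 1. *)
Lemma quad_unit_norm (w : algC) : K w -> w != 0 -> w \in Aint -> w^-1 \in Aint -> `|w| = 1.
Proof.
have ge1 v : K v -> v != 0 -> v \in Aint -> 1 <= `|v| ^+ 2.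
  move=> Kv v0 vA; rewrite normCK -[v * v^*]ger0_norm ?mul_conjC_ge0//.
  rewrite norm_intr_ge1// ?mul_conjC_eq0//.
  by rewrite Cint_rat_Aint ?quad_field_norm ?rpredM ?Aint_aut.
move=> Kw w0 wA wVA; have := ge1 _ Kw w0 wA.
have := ge1 _ (quad_fieldV Kw) _ wVA; rewrite invr_eq0 => /(_ w0).
rewrite normfV exprVn => h1 h2.
apply/eqP; rewrite -(@pexpr_eq1 _ _ 2)// eq_le h2 andbT.
by rewrite -invr_ge1 ?exprn_gt0 ?normr_gt0// unitfE expf_neq0 ?normr_eq0.
Qed.

(* An ideal whose [n]-th power is generated by [th ^+ n] is [root_ideal th].  Such
   ideals multiply like the [th] as soon as they are invertible, which makes any
   theory of ideal factorization unnecessary. *)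
Definition root_ideal (th : algC) : set algC := [set x | K x /\ x / th \in Aint]%classic.

(** A partition of unity: 1 is a finite sum of products from the two ideals. This can fail, since
    [th] need not lie in the field. *)
Definition root_invertible (th : algC) : Prop :=
  ideal_mul (root_ideal th) (root_ideal th^-1) 1.

Lemma frac_ideal_root (n : nat) (th : algC) : (0 < n)%N -> th != 0 -> th \in Aint ->
  K (th ^+ n) -> frac_ideal d (root_ideal th).
Proof.
move=> n0 th0 thA Kth; split.
- by move=> x [].
- move=> x y [Kx xA] [Ky yA]; split; first by apply: quad_fieldD => //; exact: quad_fieldN.
  by rewrite mulrBl rpredB.
- move=> a x [Ka aA] [Kx xA]; split; first exact: quad_fieldM.
  by rewrite -mulrA rpredM.
- exists (th ^+ n); last by rewrite expf_neq0.
  by split=> //; rewrite -(prednK n0) exprSr mulfK// rpredX.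
- exists 1; first by split; [exact: (quad_field_int 1)|exact: rpred1].
  split; first exact: oner_neq0.
  by move=> x [Kx xA]; rewrite mul1r; split=> //; rewrite -(divfK th0 x) rpredM.
Qed.

Lemma ideal_mul_root (th et : algC) : th != 0 -> et != 0 -> root_invertible th ->
  ideal_mul (root_ideal th) (root_ideal et) = root_ideal (th * et).
Proof.
move=> th0 et0 [s sP s1]; apply/seteqP; split=> x.
  move=> [t tP ->]; rewrite big_seq; elim/big_ind: _.
  - by split; [exact: (quad_field_int 0)|rewrite mul0r rpred0].
  - by move=> y z [Ky yA] [Kz zA]; split; [exact: quad_fieldD|rewrite mulrDl rpredD].
  - move=> u /tP[[Ku uA] [Kv vA]]; split; first exact: quad_fieldM.
    by rewrite invfM mulrACA rpredM.
(* The partition of unity multiplied by [x]: the first factors stay in the ideal of [th], and [x]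
   carries the second ones into the ideal of [et]. *)
move=> [Kx xA]; exists [seq (u.1, u.2 * x) | u <- s].
  move=> _ /mapP[u /sP[uI [Kv vA]] ->]; split=> //=; split; first exact: quad_fieldM.
  have -> : u.2 * x / et = (u.2 / th^-1) * (x / (th * et)).
    by rewrite invrK; field; rewrite et0 th0.
  exact: rpredM.
by rewrite big_map /= -[LHS]mul1r s1 mulr_suml; apply: eq_bigr => u _; rewrite mulrA.
Qed.

Lemma root_invertibleM (th et : algC) : th != 0 -> et != 0 ->
  root_invertible th -> root_invertible et -> root_invertible (th * et).
Proof.
move=> th0 et0 [s sP s1] [t tP t1].
exists [seq (u.1 * v.1, u.2 * v.2) | u <- s, v <- t].
  move=> _ /allpairsP[[u v] [/sP[[Ku uA] [Ku' uA']] /tP[[Kv vA] [Kv' vA']] ->]] /=.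
  split; (split; first exact: quad_fieldM).
    by rewrite invfM mulrACA rpredM.
  by rewrite !invfM mulrACA rpredM.
rewrite big_allpairs_dep -[LHS]mul1r {1}s1 t1 mulr_suml; apply: eq_bigr => u _.
by rewrite mulr_sumr; apply: eq_bigr => v _; rewrite /= mulrACA.
Qed.

Lemma root_invertible1 : root_invertible 1.
Proof.
have o : root_ideal 1 1 by split; [exact: (quad_field_int 1)|rewrite divr1 rpred1].
exists [:: (1, 1)]; last by rewrite big_seq1 mulr1.
by move=> u; rewrite inE => /eqP->; rewrite invr1.
Qed.

Lemma root_invertibleX (th : algC) n : th != 0 -> root_invertible th -> root_invertible (th ^+ n).
Proof.
move=> th0 h; elim: n => [|n IH]; first exact: root_invertible1.
by rewrite exprS; apply: root_invertibleM => //; rewrite expf_neq0.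
Qed.

Lemma root_invertible_quad (c : algC) : c != 0 -> K c -> root_invertible c.
Proof.
move=> c0 Kc; exists [:: (c, c^-1)]; last by rewrite big_seq1 mulfV.
move=> u; rewrite inE => /eqP-> /=; split; split=> //.
- by rewrite mulfV ?rpred1.
- exact: quad_fieldV.
- by rewrite mulfV ?rpred1// invr_eq0.
Qed.

Lemma image_root_ideal (c th : algC) : c != 0 -> K c ->
  [set c * x | x in root_ideal th]%classic = root_ideal (c * th).
Proof.
move=> c0 Kc; apply/seteqP; split=> x.
  move=> [y [Ky yA] <-]; split; first exact: quad_fieldM.
  by rewrite invfM mulrACA divff// mul1r.
move=> [Kx xA]; exists (x / c); last by rewrite mulrC divfK.
by split; [exact: quad_fieldF|rewrite -mulrA -invfM].
Qed.

Lemma ideal_equiv_root (th : algC) J : ideal_equiv d (root_ideal th) J <->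
  exists2 c, K c & c != 0 /\ J = root_ideal (c * th).
Proof.
by split=> -[c Kc [c0 ->]]; exists c => //; rewrite image_root_ideal.
Qed.

Lemma ideal_class_root (c th : algC) : c != 0 -> K c ->
  ideal_class d (root_ideal (c * th)) = ideal_class d (root_ideal th).
Proof.
move=> c0 Kc; apply/seteqP; split=> J [FJ /ideal_equiv_root[e Ke [e0 JE]]]; split=> //;
  apply/ideal_equiv_root.
  by exists (e * c); [exact: quad_fieldM|rewrite mulf_neq0// -mulrA].
exists (e / c); first exact: quad_fieldF.
by rewrite mulf_neq0 ?invr_neq0// mulrA divfK.
Qed.

Lemma Cl_mul_root (th et : algC) : th != 0 -> et != 0 ->
  root_invertible th -> frac_ideal d (root_ideal th) -> frac_ideal d (root_ideal et) ->
  Cl_mul d (ideal_class d (root_ideal th)) (ideal_class d (root_ideal et)) =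
  ideal_class d (root_ideal (th * et)).
Proof.
move=> th0 et0 ith Fth Fet; apply/seteqP; split=> L.
  move=> [FL [I [J [[_ /ideal_equiv_root[a Ka [a0 ->]]]
    [_ /ideal_equiv_root[b Kb [b0 ->]]] ]]]].
  rewrite ideal_mul_root ?mulf_neq0//; last first.
    by apply: root_invertibleM => //; exact: root_invertible_quad.
  move=> /ideal_equiv_root[c Kc [c0 LE]]; split=> //.
  apply/ideal_equiv_root; exists (c * (a * b)).
    by apply: quad_fieldM => //; exact: quad_fieldM.
  by rewrite !mulf_neq0//; split=> //; rewrite LE; congr root_ideal; ring.
move=> [FL eL]; split=> //; exists (root_ideal th), (root_ideal et).
rewrite ideal_mul_root//.
have refl z : ideal_equiv d (root_ideal z) (root_ideal z).
  apply/ideal_equiv_root; exists 1; first exact: (quad_field_int 1).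
  by rewrite mul1r oner_neq0.
by split.
Qed.

(** If [root_ideal 1] is [a] times [root_ideal th], then [c = a^-1]. Membership of 1 shows that
    [c / th] is integral; for [th / c] the partition of unity is multiplied by [a th], each [a u.1]
    being integral. *)
Lemma root_ideal_principal (th : algC) : th != 0 -> root_invertible th ->
  frac_ideal d (root_ideal th) ->
  ideal_class d (root_ideal th) = ideal_class d (root_ideal 1) ->
  exists c, [/\ K c, c != 0, c / th \in Aint & th / c \in Aint].
Proof.
move=> th0 [s sP s1] Fth e.
have O1 : root_ideal 1 1 by split; [exact: (quad_field_int 1)|rewrite divr1 rpred1].
have : ideal_class d (root_ideal 1) (root_ideal 1).
  split; first exact: (@frac_ideal_root 1 1) (oner_neq0 _) (rpred1 _) (quad_field_int 1).
  apply/ideal_equiv_root; exists 1; first exact: (quad_field_int 1).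
  by rewrite mul1r oner_neq0.
rewrite -e => -[_ [a Ka [a0 E]]]; exists a^-1; split.
- exact: quad_fieldV.
- by rewrite invr_eq0.
- have : root_ideal 1 1 by []. rewrite E => -[x [Kx xA] ax1].
  by rewrite (_ : a^-1 = x)// -[LHS]mulr1 -ax1 mulKf.
- have -> : th / a^-1 = \sum_(u <- s) (a * u.1) * (u.2 * th).
    rewrite invrK -[LHS]mulr1 {1}s1 mulr_sumr; apply: eq_bigr => u _.
    by rewrite mulrACA [th * _ * _]mulrC; ring.
  rewrite big_seq rpred_sum// => u /sP[uI [Kv vA]].
  rewrite rpredM//; last by rewrite invrK in vA.
  have [_] : root_ideal 1 (a * u.1) by rewrite E; exists u.1.
  by rewrite divr1.
Qed.
End QuadraticField.

(** * Comaximal algebraic integers, and [g]-th roots of quadratic integers *)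

Definition Aint_comax (a b : algC) : Prop :=
  exists2 l, l \in Aint & exists2 m, m \in Aint & l * a + m * b = 1.

Lemma Aint_comaxC (a b : algC) : Aint_comax a b -> Aint_comax b a.
Proof. by move=> [l lA [m mA e]]; exists m => //; exists l => //; rewrite addrC. Qed.

Lemma Aint_comaxMl (a b c : algC) : a \in Aint -> b \in Aint -> c \in Aint ->
  Aint_comax a c -> Aint_comax b c -> Aint_comax (a * b) c.
Proof.
move=> aA bA cA [l lA [m mA e]] [l' lA' [m' mA' e']].
exists (l * l'); first exact: rpredM.
exists (l * a * m' + m * (l' * b + m' * c)); last by rewrite -[RHS]mulr1 -{1}e -e'; ring.
by rewrite !(rpredD, rpredM).
Qed.

Lemma Aint_comaxXl (a c : algC) n : a \in Aint -> c \in Aint ->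
  Aint_comax a c -> Aint_comax (a ^+ n) c.
Proof.
move=> aA cA h; elim: n => [|n IH].
  by exists 1; rewrite ?rpred1//; exists 0; rewrite ?rpred0// expr0 mul0r addr0 mulr1.
by rewrite exprS; apply: Aint_comaxMl => //; rewrite rpredX.
Qed.

Lemma Aint_comaxX (a b : algC) n : a \in Aint -> b \in Aint ->
  Aint_comax a b -> Aint_comax (a ^+ n) (b ^+ n).
Proof.
move=> aA bA h; apply: Aint_comaxXl; rewrite ?rpredX//.
by apply/Aint_comaxC/Aint_comaxXl => //; exact: Aint_comaxC.
Qed.

(* [A] generates, in a larger ring, an ideal of norm [z] whose [g]-th power is
   generated by [(x + e r) / 2]; the sign [e] allows for conjugation. *)
Definition power_root (g d z : nat) (x e : int) (A : algC) : Prop :=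
  [/\ A \in Aint, A * A^* = z%:R
    & A ^+ g = (x%:~R + e%:~R * sqrtC (- d%:R)) / 2].

Section PowerRoot.
Variables (g d z : nat) (x e : int) (A : algC).
Hypotheses (g_gt1 : (1 < g)%N) (sqf_d : squarefree d).
Hypotheses (normE : d%:Z + x ^+ 2 = 4 * z%:Z ^+ g).

Let g_gt0 : (0 < g)%N. Proof. exact: ltnW. Qed.

Lemma power_base_gt0 : (0 < z)%N.
Proof.
have d0 := squarefree_gt0 sqf_d.
rewrite lt0n; apply/negP => /eqP z0; move: normE; rewrite z0 expr0n.
by rewrite gtn_eqF// mulr0; nia.
Qed.

(** For even [x] the number [d = 4 z^g - x^2] would be divisible by 4. *)
Lemma power_trace_odd : exists m : int, x = 2 * m + 1.
Proof.
exists ((x %/ 2)%Z); rewrite {1}(divz_eq x 2) mulrC.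
suff : (x %% 2)%Z != 0 by lia.
apply/negP => /eqP x0.
have xE : x = (x %/ 2)%Z * 2 by lia.
suff : 2%N = 1%N by [].
apply: (squarefree_sqr_dvd sqf_d); rewrite -[X in (_ %| X)%N](absz_nat d).
apply/(@dvdzP 4%:Z); exists (z%:Z ^+ g - (x %/ 2)%Z ^+ 2).
have := normE; move: (z%:Z ^+ g) => Z; nia.
Qed.

(** The square of a common divisor divides [x^2], and also [z^g] because [g > 1]; hence it divides
    [d]. *)
Lemma power_coprime : coprime `|x| z.
Proof.
have qx : (gcdn `|x| z %| `|x|)%N by exact: dvdn_gcdl.
have qz : (gcdn `|x| z %| z)%N by exact: dvdn_gcdr.
apply/eqP/(squarefree_sqr_dvd sqf_d); rewrite -[X in (_ %| X)%N](absz_nat d).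
have -> : d%:Z = 4 * z%:Z ^+ g - x ^+ 2 by rewrite -normE addrK.
suff : ((gcdn `|x| z ^ 2)%N%:Z %| 4 * z%:Z ^+ g - x ^+ 2)%Z by rewrite dvdzE.
rewrite rpredB//; last by rewrite dvdzE abszX dvdn_exp2r.
rewrite dvdz_mull// dvdzE abszX /=.
by apply: dvdn_trans (dvdn_exp2l _ g_gt1); exact: dvdn_exp2r.
Qed.

(** Any [g]-th root of [(x + sqrt(-d)) / 2] will do. That number is a zero of [X^2 - x X + z^g], so
    the root is integral; the product of the root with its conjugate is a nonnegative real, hence
    determined by its [g]-th power [z^g]. *)
Lemma power_root_exists : exists B, power_root g d z x 1 B.
Proof.
have r2 := sqr_sqrtCN d.
have [B BE] : exists B : algC, B ^+ g = (x%:~R + 1%:~R * sqrtC (- d%:R)) / 2.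
  by exists (g.-root ((x%:~R + 1%:~R * sqrtC (- d%:R)) / 2)); rewrite rootCK.
have nE : (d%:R + x%:~R ^+ 2) = 4 * z%:R ^+ g :> algC.
  have := congr1 (fun t : int => t%:~R : algC) normE.
  by rewrite /= !(rmorphD, rmorphM, rmorphXn).
have cE : (B ^+ g)^* = (x%:~R - sqrtC (- d%:R)) / 2.
  rewrite BE mul1r !(rmorphD, rmorphM) /= fmorphV rmorph_nat rmorph_int.
  by rewrite conj_sqrtCN.
exists B; split=> //.
- apply: (Aint_expr_inv g_gt0); apply: (@root_monic_Aint ('X^2 - (x%:~R *: 'X) + (z%:R ^+ g)%:P)).
  + rewrite /root !hornerE BE; apply/eqP.
    have : z%:R ^+ g = (d%:R + x%:~R ^+ 2) / 4 :> algC by rewrite nE [4 * _]mulrC mulfK// pnatr_eq0.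
    by move=> ->; field: r2.
  + rewrite monicE -addrA lead_coefDl ?lead_coefXn// size_polyXn.
    apply: leq_ltn_trans (size_polyD _ _) _; rewrite gtn_max size_polyN.
    by rewrite (leq_ltn_trans (size_scale_leq _ _)) ?size_polyX//= ltnS (leq_trans (size_polyC_leq1 _)).
  + apply/polyOverP => i; rewrite coefD coefB coefXn coefZ coefX coefC.
    rewrite rpredD ?rpredB ?rpredM ?rpred_nat ?rpred_int//.
    by case: ifP; rewrite ?rpred0// rpredX// rpred_nat.
- apply/eqP; rewrite -(@eqrXn2 _ g) ?mul_conjC_ge0 ?ler0n// exprMn -rmorphXn /= cE BE.
  apply/eqP; have : z%:R ^+ g = (d%:R + x%:~R ^+ 2) / 4 :> algC by rewrite nE [4 * _]mulrC mulfK// pnatr_eq0.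
  by move=> ->; field: r2.
Qed.

Lemma power_root_conj : power_root g d z x e A -> power_root g d z x (- e) A^*.
Proof.
move=> [AA AN AE]; split.
- by rewrite Aint_aut.
- by rewrite conjCK mulrC.
- rewrite -rmorphXn /= AE !(rmorphD, rmorphM) /= fmorphV rmorph_nat !rmorph_int.
  by rewrite conj_sqrtCN// mulrN rmorphN mulNr.
Qed.

Hypothesis rootA : power_root g d z x e A.

Lemma power_root_neq0 : A != 0.
Proof.
have [_ AN _] := rootA; apply/eqP => A0; move: AN; rewrite A0 mul0r => /eqP.
by rewrite eq_sym pnatr_eq0 gtn_eqF// power_base_gt0.
Qed.

Lemma power_root_quad : quad_field d (A ^+ g).
Proof.
have [_ _ ->] := rootA; apply: quad_fieldF => //; last exact: (quad_field_int _ 2).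
apply: quad_fieldD; first exact: quad_field_int.
by apply: quad_fieldM; [exact: quad_field_int|exact: quad_field_sqrtCN].
Qed.

Lemma power_root_trace : A ^+ g + A^* ^+ g = x%:~R.
Proof.
have [_ _ ->] := rootA; have [_ _ ->] := power_root_conj rootA.
by rewrite rmorphN; field.
Qed.

Lemma power_root_norm : `|A| ^+ 2 = z%:R.
Proof. by have [_ <- _] := rootA; rewrite normCK. Qed.

Lemma power_root_bezout : exists m n : int, m%:~R * x%:~R + n%:~R * z%:R = 1 :> algC.
Proof.
have [u [v uv]] : exists u v : int, u * x + v * z%:Z = 1.
  have /coprimezP : coprimez x z by exact: power_coprime.
  by case=> -[u v] /= h; exists u, v.
exists u, v; have := congr1 (fun t : int => t%:~R : algC) uv.
by rewrite /= !(rmorphD, rmorphM).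
Qed.

(** The sum [x] and the product [z^g] of the two numbers are coprime integers, and both are
    combinations of the two. This stands for the coprimality of an ideal with its conjugate. *)
Lemma power_root_comax : Aint_comax (A ^+ g) (A^* ^+ g).
Proof.
have [AA AN _] := rootA.
have [m [n mn]] := power_root_bezout.
have : Aint_comax (z%:R ^+ g) x%:~R.
  apply: Aint_comaxXl; rewrite ?Aint_int ?rpred_nat//.
  by exists n%:~R; rewrite ?Aint_int//; exists m%:~R; rewrite ?Aint_int// addrC.
move=> [l lA [k kA]]; rewrite -power_root_trace -AN exprMn => h.
exists k => //; exists (k + l * A ^+ g); first by rewrite rpredD// rpredM// rpredX.
by rewrite -h; ring.
Qed.

Lemma power_root_invertible : root_invertible d A.
Proof.
have [AA AN AE] := rootA; have A0 := power_root_neq0.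
have z0 : z%:R != 0 :> algC by rewrite pnatr_eq0 -lt0n power_base_gt0.
have cA0 : A^* != 0 by rewrite conjC_eq0.
have [m [n mn]] := power_root_bezout.
have KA := power_root_quad.
have KcA : quad_field d (A^* ^+ g) by rewrite -rmorphXn; exact: quad_field_conj.
have cAA : A^* \in Aint by rewrite Aint_aut.
have zA : z%:R / A = A^* by rewrite -AN mulrC mulKf.
(* The relation [m x + n z = 1], where [x] is the sum of [A^g] and its conjugate, split into three
   products. Only [A^g], its conjugate and integers are known to be in the field; in the middle pair
   a factor [z] is shifted between the two entries so that each meets its own integrality
   condition. *)
exists [:: (m%:~R * A ^+ g, 1); (m%:~R * z%:R, A^* ^+ g / z%:R); (n%:~R * z%:R, 1)].
  have K1 : root_ideal d A^-1 1.
    by split; [exact: (quad_field_int _ 1)|rewrite mul1r invrK].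
  move=> u; rewrite !inE => /or3P[] /eqP-> /=; split=> //.
  - split; first by apply: quad_fieldM => //; exact: quad_field_int.
    by rewrite -mulrA rpredM ?Aint_int// -(prednK g_gt0) exprSr mulfK// rpredX.
  - split; first by apply: quad_fieldM; [exact: quad_field_int|exact: (quad_field_int _ z)].
    by rewrite -mulrA rpredM ?Aint_int// zA.
  - split; first by apply: quad_fieldF => //; exact: (quad_field_int _ z).
    rewrite invrK -AN invfM mulrA -(prednK g_gt0) exprSr.
    rewrite (_ : _ * A = A^* ^+ g.-1); last by field; rewrite A0 cA0.
    by rewrite rpredX.
  - split; first by apply: quad_fieldM; [exact: quad_field_int|exact: (quad_field_int _ z)].
    by rewrite -mulrA rpredM ?Aint_int// zA.
rewrite !big_cons big_nil /= -[LHS]mn -power_root_trace.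
by field.
Qed.

End PowerRoot.

(** * Two independent classes of order g *)

Lemma leq_expn_base (m n k : nat) : (m <= n)%N -> (m ^ k <= n ^ k)%N.
Proof. by case: k => // k mn; rewrite leq_exp2r. Qed.

Lemma sqr_int_eq1 (a : int) : a ^+ 2 = 1 -> a = 1 \/ a = -1.
Proof. by move=> /eqP; rewrite sqrf_eq1 => /orP[]/eqP; [left|right]. Qed.

(** There are four patterns for the signs [ep] and [e1 e2]: three contradict the oddness of [x], and
    the fourth gives [E = 0]. For [ep = 1] and [e1 e2 = -1] the relation becomes
    [2 Z = x^2 - 4 E x + 4 E^2], and here the divisibility of the sum of the traces by 8 matters. *)
Lemma half_power_arith (D E Z m x e1 e2 ep : int) :
  e1 ^+ 2 = 1 -> e2 ^+ 2 = 1 -> ep ^+ 2 = 1 -> E != 0 -> x = 2 * m + 1 ->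
  D + x ^+ 2 = 4 * Z ->
  4 * (D + ep * (x * (8 * E - x) - e1 * e2 * D)) = (x * e2 + (8 * E - x) * e1) ^+ 2 ->
  False.
Proof.
move=> h1 h2 he E0 x1m n1'.
have pp : e1 * e2 = 1 /\ e1 = e2 \/ e1 * e2 = -1 /\ e1 = - e2.
  by case: (sqr_int_eq1 h1) => ->; case: (sqr_int_eq1 h2) => ->; [left|right|right|left].
case: pp => -[ee e12]; rewrite ee e12; case: (sqr_int_eq1 he) => -> c4.
- have : (x - 4 * E) ^+ 2 = 0.
    by move: c4 h2; rewrite -mulrDl exprMn => c4 h2; rewrite h2 in c4; lra.
  by move/eqP; rewrite sqrf_eq0 subr_eq0 => /eqP; clear -x1m; lia.
- move: c4; rewrite -mulrDl exprMn h2 => c4.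
  have : 2 * D = 16 * E ^+ 2 + 8 * (E * x) - x ^+ 2 by lra.
  by rewrite x1m; move: (E ^+ 2) => E2; rewrite sqrrD; clear; lia.
- have c5 : (x * e2 + (8 * E - x) * - e2) ^+ 2 = (2 * x - 8 * E) ^+ 2.
    by rewrite (_ : _ + _ = (2 * x - 8 * E) * e2) ?exprMn ?h2 ?mulr1//; ring.
  rewrite c5 in c4.
  have : 2 * Z = x ^+ 2 - 4 * (E * x) + 4 * E ^+ 2 by lra.
  by rewrite x1m; move: (E ^+ 2) => E2; rewrite sqrrD; clear; lia.
- have c5 : (x * e2 + (8 * E - x) * - e2) ^+ 2 = (2 * x - 8 * E) ^+ 2.
    by rewrite (_ : _ + _ = (2 * x - 8 * E) * e2) ?exprMn ?h2 ?mulr1//; ring.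
  rewrite c5 in c4.
  have : E ^+ 2 = 0 by lra.
  by move/eqP; rewrite sqrf_eq0 (negPf E0).
Qed.

Section Embedding.
Variables (g d z1 z2 : nat) (x1 x2 E : int).
Hypotheses (g_gt1 : (1 < g)%N) (sqf_d : squarefree d).
Hypotheses (n1 : d%:Z + x1 ^+ 2 = 4 * z1%:Z ^+ g) (n2 : d%:Z + x2 ^+ 2 = 4 * z2%:Z ^+ g).
Hypotheses (z21 : (z2 < z1)%N) (z12 : (z1 ^ g <= 2 * z2 ^ g)%N).
Hypotheses (dz : (3 * z2 ^ g <= d)%N) (z2_big : (2 ^ g < z2)%N).
Hypothesis xE : x1 + x2 = 8 * E.

Let g_gt0 : (0 < g)%N. Proof. exact: ltnW. Qed.

Let z2_gt4 : (4 < z2)%N.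
Proof. by apply: leq_ltn_trans z2_big; rewrite (@leq_exp2l 2 2). Qed.

(** As [z1 >= 5], one has [5 z1^(g-1) <= z1^g <= 2 z2^g], whereas [d >= 3 z2^g]. An integer of the
    field whose norm is below [d / 4] is rational, and this is what the bound is for. *)
Lemma two_powers_size i j : (i + j < g)%N -> (4 * (z1 ^ i * z2 ^ j) < d)%N.
Proof.
move=> ij.
have z1_gt0 : (0 < z1)%N by lia.
have h1 : (z1 ^ i * z2 ^ j <= z1 ^ g.-1)%N.
  apply: (@leq_trans (z1 ^ i * z1 ^ j)%N); first by rewrite leq_mul2l leq_expn_base ?orbT// ltnW.
  by rewrite -expnD leq_pexp2l//; lia.
have h2 : (z1 * z1 ^ g.-1 <= 2 * z2 ^ g)%N by rewrite -expnS prednK.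
have h3 : (5 * z1 ^ g.-1 <= 2 * z2 ^ g)%N.
  by apply: leq_trans h2; rewrite leq_mul2r; apply/orP; right; lia.
have h4 : (0 < z2 ^ g)%N by rewrite expn_gt0; lia.
nia.
Qed.

(** For [j <= i] the inequality [z2 < z1] decides. For [i < j] one gets
    [z2^(i+1) <= z1^i <= (2 z2)^i], so that [z2 <= 2^g], against [z2_big]. *)
Lemma two_powers_neq i j : (i <= g)%N -> (z1 ^ i = z2 ^ j)%N -> i = 0%N /\ j = 0%N.
Proof.
move=> ig e; have [ji|ij] := leqP j i.
  have [i0|i0] := posnP i.
    by split=> //; move: ji; rewrite i0 leqn0 => /eqP.
  have h1 : (z2 ^ j <= z2 ^ i)%N by rewrite leq_pexp2l//; lia.
  have h2 : (z2 ^ i < z1 ^ i)%N by rewrite ltn_exp2r.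
  lia.
have h1 : (z2 * z2 ^ i <= z1 ^ i)%N by rewrite -expnS e leq_pexp2l//; lia.
have zz : (z1 <= 2 * z2)%N.
  rewrite -(@leq_exp2r _ _ g)// expnMn; apply: leq_trans z12 _.
  by rewrite leq_mul2r -{1}(expn1 2) leq_exp2l// g_gt0 orbT.
have h2 : (z1 ^ i <= 2 ^ i * z2 ^ i)%N.
  by rewrite -expnMn leq_expn_base.
have h3 : (2 ^ i <= 2 ^ g)%N by rewrite leq_exp2l.
have h4 : (0 < z2 ^ i)%N by rewrite expn_gt0; lia.
have : (z2 * z2 ^ i <= 2 ^ i * z2 ^ i)%N by apply: leq_trans h2.
by rewrite leq_pmul2r//; lia.
Qed.

(* If the product of the two powers of exponent [g / 2] is principal, the square of a
   generator [(U + V r) / 2] is [ep] times the product of [(x1 + e1 r) / 2] and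
   [(x2 + e2 r) / 2]. *)
Lemma half_power_contradiction (e1 e2 ep U V : int) :
  e1 ^+ 2 = 1 -> e2 ^+ 2 = 1 -> ep ^+ 2 = 1 -> V ^+ 2 = 1 ->
  U ^+ 2 - d%:Z * V ^+ 2 = ep * (x1 * x2 - e1 * e2 * d%:Z) ->
  2 * U * V = ep * (x1 * e2 + x2 * e1) -> False.
Proof.
move=> h1 h2 he hV c1 c2.
have xneq : x1 ^+ 2 != x2 ^+ 2.
  apply/negP => /eqP e; have : z1%:Z ^+ g = z2%:Z ^+ g.
    by move: n1 n2; rewrite e; move: (z1%:Z ^+ g) (z2%:Z ^+ g); clear; lia.
  by move/eqP; rewrite eqrXn2// eqz_nat gtn_eqF.
have [m x1m] := power_trace_odd g_gt1 sqf_d n1.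
have x2E : x2 = 8 * E - x1 by rewrite -xE addrC addKr.
have c3 : 4 * U ^+ 2 = (x1 * e2 + x2 * e1) ^+ 2.
  have := congr1 (fun t : int => t ^+ 2) c2.
  by rewrite /= !exprMn hV he mulr1 mul1r.
rewrite hV mulr1 in c1; move: n1 c1 c3; rewrite x2E.
move: (z1%:Z ^+ g) => Z n1' c1 c3.
have c4 : 4 * (d%:Z + ep * (x1 * (8 * E - x1) - e1 * e2 * d%:Z)) = (x1 * e2 + (8 * E - x1) * e1) ^+ 2.
  by rewrite -c3 -c1; ring.
have E0 : E != 0 by apply: contraNneq xneq => E0; rewrite x2E E0 mulr0 sub0r sqrrN.
exact: (half_power_arith h1 h2 he E0 x1m n1' c4).
Qed.

(** The norm of [c] is [z1^i z2^j]. If [c] is not rational, the size of [d] forces [i = j = g / 2],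
    and the sign argument excludes this. If [c] is rational, its absolute value turns out to be
    [z2^j], and the norm then gives [z1^i = z2^j]. *)
Lemma principal_power_trivial (A B c : algC) (e1 e2 : int) i j :
  e1 ^+ 2 = 1 -> e2 ^+ 2 = 1 ->
  power_root g d z1 x1 e1 A -> power_root g d z2 x2 e2 B ->
  (i.*2 <= g)%N -> (j.*2 <= g)%N ->
  quad_field d c -> c != 0 ->
  c / (A ^+ i * B ^+ j) \in Aint -> A ^+ i * B ^+ j / c \in Aint ->
  i = 0%N /\ j = 0%N.
Proof.
move=> e1_2 e2_2 rA rB ig jg Kc c0 uA uVA.
have A0 := power_root_neq0 g_gt1 sqf_d n1 rA.
have B0 := power_root_neq0 g_gt1 sqf_d n2 rB.
have NA := power_root_norm rA; have NB := power_root_norm rB.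
have KA := power_root_quad sqf_d rA; have KB := power_root_quad sqf_d rB.
have [AA AN AE] := rA; have [BA BN BE] := rB.
have th0 : A ^+ i * B ^+ j != 0 by rewrite mulf_neq0// expf_neq0.
set u := c / (A ^+ i * B ^+ j) in uA.
have u0 : u != 0 by rewrite mulf_neq0// invr_neq0.
have uV : u^-1 \in Aint by rewrite invfM invrK mulrC.
have cE : c = u * (A ^+ i * B ^+ j) by rewrite divfK.
have uE : u = c / (A ^+ i * B ^+ j) by [].
clearbody u.
have Ku : quad_field d (u ^+ g).
  rewrite uE exprMn exprVn exprMn; apply: quad_fieldF => //; first exact: quad_fieldX.
  by rewrite -!exprM mulnC [(j * g)%N]mulnC !exprM; apply: quad_fieldM => //; exact: quad_fieldX.
have nug : `|u ^+ g| = 1.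
  by apply: (quad_unit_norm sqf_d Ku); rewrite ?expf_neq0 ?rpredX// -exprVn rpredX.
have nu : `|u| = 1.
  by apply/eqP; rewrite -(@pexpr_eq1 _ _ g)// -normrX nug.
have nc : `|c| ^+ 2 = (z1 ^ i * z2 ^ j)%N%:R.
  rewrite cE !normrM nu mul1r !normrX exprMn -!exprM mulnC [(j * 2)%N]mulnC !exprM NA NB.
  by rewrite natrM !natrX.
have cA : c \in Aint by rewrite cE rpredM// rpredM// rpredX.
have /quad_fieldP[a Qa [b Qb cab]] := Kc.
rewrite cab in cA; have [U [V [aU bV nUV]]] := quad_int_coord sqf_d Qa Qb cA.
have nI : U ^+ 2 + d%:Z * V ^+ 2 = 4 * (z1 ^ i * z2 ^ j)%N%:Z.
  have h : U%:~R ^+ 2 = 4 * (z1%:R ^+ i * z2%:R ^+ j) - d%:R * V%:~R ^+ 2 :> algC.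
    by rewrite -!natrX -natrM -nc cab nUV [4 * _]mulrC divfK ?pnatr_eq0// addrK.
  apply: (@intr_inj algC); rewrite !(rmorphD, rmorphM) /= !rmorphXn /= -!pmulrn.
  by ring: h.
have [V0|V0] := eqVneq V 0; last first.
  have V1 : 1 <= V ^+ 2 by rewrite -gtz0_ge1 exprn_even_gt0.
  have dle : (d <= 4 * (z1 ^ i * z2 ^ j))%N.
    have : 0 <= U ^+ 2 by exact: sqr_ge0.
    move: V1 nI; move: (V ^+ 2) (U ^+ 2) ((z1 ^ i * z2 ^ j)%N) => v w m; clear; nia.
  have [ij|ij] := ltnP (i + j)%N g.
    by have := two_powers_size ij; rewrite ltnNge dle.
  have ji : j = i by clear -ij ig jg; lia.
  have gi : g = i.*2 by clear -ij ig jg; lia.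
  rewrite ji in nI dle uA th0 cE u0 nu nug Ku uV uVA *.
  exfalso.
  (* The unit [u] may lie outside the field, but for [g = 2 i] its square is inside, because
     [A^g B^g] is. For [d > 4] a unit of the field is 1 or -1. *)
  pose w := u ^+ 2.
  have ABg : (A ^+ i * B ^+ i) ^+ 2 = A ^+ g * B ^+ g.
    by rewrite exprMn -!exprM gi -mul2n mulnC.
  have wE : w = c ^+ 2 / (A ^+ g * B ^+ g) by rewrite -ABg -expr_div_n /w uE ji.
  have Kw : quad_field d w.
    rewrite wE; apply: quad_fieldF => //; first exact: quad_fieldX.
    exact: quad_fieldM.
  have /quad_fieldP[p Qp [q Qq wpq]] := Kw.
  have wA : p + q * sqrtC (- d%:R) \in Aint by rewrite -wpq rpredX.
  have [U' [V' [pU qV nw]]] := quad_int_coord sqf_d Qp Qq wA.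
  have nI' : U' ^+ 2 + d%:Z * V' ^+ 2 = 4.
    have h : U'%:~R ^+ 2 = 4 - d%:R * V'%:~R ^+ 2 :> algC.
      have four0 : 4 != 0 :> algC by rewrite pnatr_eq0.
      move: nw; rewrite -wpq normrX nu !expr1n => /esym/(canRL (divfK four0)).
      by rewrite mul1r => <-; rewrite addrK.
    apply: (@intr_inj algC); rewrite !(rmorphD, rmorphM) /= -!pmulrn.
    by ring: h.
  have dgt : (4 < d)%N.
    apply: leq_trans dz; apply: (leq_trans z2_gt4).
    by rewrite -[X in (X <= _)%N]mul1n leq_mul// -{1}(expn1 z2) leq_pexp2l//; exact: leq_trans z2_gt4.
  have V'0 : V' = 0 by move: nI' dgt; clear; move: (sqr_ge0 U') => ?; nia.
  have [ep epE ep2] : exists2 ep : int, w = ep%:~R & ep ^+ 2 = 1.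
    have : U' = 2 \/ U' = -2 by move: nI'; rewrite V'0; clear; nia.
    move: wpq; rewrite pU qV V'0 => wpq [] U'E; [exists 1|exists (-1)] => //;
      by rewrite wpq U'E; field.
  (* With [m = z1^i z2^i], the bounds [m^2 <= 2 (z2^g)^2] and [3 z2^g <= d] give [2 m < d]; since
     [d V^2 <= 4 m], this leaves [V^2 < 2]. *)
  have V21 : V ^+ 2 = 1.
    have m2 : ((z1 ^ i * z2 ^ i) ^ 2 <= 2 * (z2 ^ g) ^ 2)%N.
      by rewrite expnMn -!(expnM _ i) muln2 -gi -mulnn mulnA leq_mul2r z12 orbT.
    move: V1 nI m2 dz (sqr_ge0 U) (squarefree_gt0 sqf_d); clear.
    move: (V ^+ 2) (U ^+ 2) ((z1 ^ i * z2 ^ i)%N) (z2 ^ g)%N => v w m z.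
    move=> v1 h mz zd w0 d0.
    have md : (2 * m < d)%N by nia.
    have [//|v2] : v = 1 \/ 2 <= v by lia.
    have : d%:Z * 2 <= d%:Z * v by rewrite ler_wpM2l.
    lia.
  have r2 := sqr_sqrtCN d.
  have c2E : c ^+ 2 = ep%:~R * (A ^+ g * B ^+ g) by rewrite -epE wE divfK// -ABg expf_neq0.
  have := c2E; rewrite cab aU bV AE BE => eqc.
  have [||||| f1 f2] := @quad_coord_inj d sqf_d (U ^+ 2 - d%:Z * V ^+ 2)%:~R (2 * U * V)%:~R
    (ep * (x1 * x2 - e1 * e2 * d%:Z))%:~R (ep * (x1 * e2 + x2 * e1))%:~R; rewrite ?rpred_int//.
    transitivity (4 * (U%:~R / 2 + V%:~R / 2 * sqrtC (- d%:R)) ^+ 2 : algC).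
      by rewrite !(rmorphB, rmorphM) /= -!pmulrn; field: r2.
    by rewrite eqc !(rmorphB, rmorphD, rmorphM) /= -!pmulrn; field: r2.
  exact: (half_power_contradiction e1_2 e2_2 ep2 V21 (intr_inj f1) (intr_inj f2)).
have cU : c \in Crat by rewrite cab bV V0 mul0r mul0r addr0.
(* As [z2] is [B] times its conjugate, [t] times the conjugate of [B^(g j)] equals [u^g A^(g i)],
   which is integral. Since [t] is rational, conjugation makes [t B^(g j)] integral as well, and
   comaximality yields [t] itself. The same argument with [A] treats [t^-1], so that [t] has
   absolute value 1. *)
pose t := c ^+ g / z2%:R ^+ (g * j).
have z20 : z2%:R != 0 :> algC by rewrite pnatr_eq0 -lt0n; exact: leq_trans z2_gt4.
have Qt : t \in Crat by rewrite rpredM ?rpredV ?rpredX// rpred_nat.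
have t0 : t != 0 by rewrite mulf_neq0 ?invr_neq0 ?expf_neq0.
have tc : t^* = t by rewrite conj_Crat.
have cB0 : B^* != 0 by rewrite conjC_eq0.
have cAA : A^* \in Aint by rewrite Aint_aut.
have cBA : B^* \in Aint by rewrite Aint_aut.
have tE : t * B^* ^+ g ^+ j = u ^+ g * A ^+ g ^+ i.
  rewrite /t -BN exprMn cE !exprMn -!exprM ![(_ * g)%N]mulnC.
  by field; rewrite !expf_neq0.
have tA : t \in Aint.
  have [l lA [m mA lm]] := Aint_comaxX j (rpredX g BA) (rpredX g cBA)
    (power_root_comax g_gt1 sqf_d n2 rB).
  rewrite -[t]mulr1 -lm mulrDr mulrCA rpredD//; last first.
    by rewrite mulrCA tE rpredM// rpredM// !rpredX.
  rewrite rpredM// -[B]conjCK -!rmorphXn /= -tc -rmorphM /= Aint_aut.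
  by rewrite !rmorphXn /= tE rpredM// !rpredX.
have tVE : t^-1 * A ^+ g ^+ i = u^-1 ^+ g * B^* ^+ g ^+ j.
  apply: (mulfI t0); rewrite mulVKf// [RHS]mulrCA tE exprVn.
  by rewrite mulKf// expf_neq0.
have tVA : t^-1 \in Aint.
  have [l lA [m mA lm]] := Aint_comaxX i (rpredX g AA) (rpredX g cAA)
    (power_root_comax g_gt1 sqf_d n1 rA).
  rewrite -[t^-1]mulr1 -lm mulrDr mulrCA rpredD//.
    by rewrite tVE rpredM// rpredM// !rpredX.
  rewrite mulrCA rpredM//.
  have -> : t^-1 * A^* ^+ g ^+ i = (t^-1 * A ^+ g ^+ i)^*.
    by rewrite rmorphM fmorphV /= tc !rmorphXn.
  by rewrite Aint_aut tVE rpredM// !rpredX.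
have nt : `|t| = 1 by exact: (quad_unit_norm sqf_d (quad_field_Crat _ Qt)).
have nc2 : `|c| = z2%:R ^+ j.
  apply/eqP; rewrite -(@eqrXn2 _ g)// ?exprn_ge0 ?ler0n// -exprM mulnC.
  move: nt; rewrite /t normf_div !normrX normr_nat => /(canRL (divfK (expf_neq0 _ z20))).
  by rewrite mul1r => ->; rewrite mulnC.
apply: (two_powers_neq (i := i) (j := j)); first by clear -ig; lia.
apply/eqP; rewrite -(@eqn_pmul2r (z2 ^ j)) ?expn_gt0; last by rewrite (leq_trans _ z2_gt4).
rewrite -(eqr_nat algC) -nc nc2 natrM natrX expr2; apply/eqP; congr (_ * _).
Qed.


(** The pair [(i, j)] goes to the class of the ideal of [A^i B^j]; reducing the exponents modulo [g]
    does not change the class, because [A^g] and [B^g] lie in the field. *)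
Lemma two_powers_embed : embeds_in_Cl ('Z_g * 'Z_g)%type d.
Proof.
have [A rA] := power_root_exists g_gt1 sqf_d n1.
have [B rB] := power_root_exists g_gt1 sqf_d n2.
have A0 := power_root_neq0 g_gt1 sqf_d n1 rA.
have B0 := power_root_neq0 g_gt1 sqf_d n2 rB.
have KA := power_root_quad sqf_d rA; have KB := power_root_quad sqf_d rB.
have [AA _ _] := rA; have [BA _ _] := rB.
have iA := power_root_invertible g_gt1 sqf_d n1 rA.
have iB := power_root_invertible g_gt1 sqf_d n2 rB.
pose th i j : algC := A ^+ i * B ^+ j.
have th0 i j : th i j != 0 by rewrite mulf_neq0// expf_neq0.
have thI i j : root_invertible d (th i j).
  by apply: root_invertibleM; rewrite ?expf_neq0//; exact: root_invertibleX.
have thF i j : frac_ideal d (root_ideal d (th i j)).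
  apply: (frac_ideal_root g_gt0) => //; first by rewrite rpredM// rpredX.
  rewrite exprMn -!exprM mulnC [(j * g)%N]mulnC !exprM.
  by apply: quad_fieldM => //; exact: quad_fieldX.
have thM (i j i' j' : nat) : ideal_class d (root_ideal d (th ((i + i') %% g)%N ((j + j') %% g)%N)) =
    Cl_mul d (ideal_class d (root_ideal d (th i j))) (ideal_class d (root_ideal d (th i' j'))).
  rewrite Cl_mul_root//.
  pose c := A ^+ g ^+ ((i + i') %/ g)%N * B ^+ g ^+ ((j + j') %/ g)%N.
  have -> : th i j * th i' j' = c * th ((i + i') %% g)%N ((j + j') %% g)%N.
    rewrite /th mulrACA -!exprD {1}(divn_eq (i + i') g) {1}(divn_eq (j + j') g).
    by rewrite !exprD ![(_ * g)%N]mulnC !exprM /c; ring.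
  rewrite ideal_class_root//; first by rewrite mulf_neq0// !expf_neq0.
  by apply: quad_fieldM => //; exact: quad_fieldX.
have Zg : (Zp_trunc g).+2 = g by exact: Zp_cast.
pose f (x : 'Z_g * 'Z_g) := ideal_class d (root_ideal d (th x.1 x.2)).
have fM x y : f (x + y) = Cl_mul d (f x) (f y).
  have modE (a : nat) : (a %% g = a %% (Zp_trunc g).+2)%N by rewrite Zg.
  by rewrite -thM !modE.
(* An exponent [i] above [g / 2] becomes [g - i] on the conjugate: [C^i] is the field element
   [C^g / z^(g-i)] times the power [g - i] of the conjugate of [C]. *)
have half (z : nat) (x : int) C i : power_root g d z x 1 C -> (0 < z)%N -> C != 0 ->
    (i < g)%N ->
  exists C' (e : int) i' ga, [/\ power_root g d z x e C', e ^+ 2 = 1, (i'.*2 <= g)%N,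
    quad_field d ga /\ ga != 0 & C ^+ i = ga * C' ^+ i' /\ (i' = 0%N -> i = 0%N)].
  move=> rC z_gt0 C0 ig; have [ih|ih] := leqP i.*2 g.
    exists C, 1, i, 1; split=> //; last by rewrite mul1r.
    by split; [exact: (quad_field_int _ 1)|exact: oner_neq0].
  have [_ CN _] := rC.
  have z0 : z%:R != 0 :> algC by rewrite pnatr_eq0 -lt0n.
  exists C^*, (-1), (g - i)%N, (C ^+ g / z%:R ^+ (g - i)); split=> //.
  - exact: power_root_conj rC.
  - by clear -ih; lia.
  - split; last by rewrite mulf_neq0 ?invr_neq0 ?expf_neq0.
    apply: quad_fieldF => //; first exact: power_root_quad rC.
    by apply: quad_fieldX => //; exact: (quad_field_int _ z).
  split; last by clear -ig; lia.
  rewrite -CN exprMn -{1}(subnKC (ltnW ig)) exprD.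
  by field; rewrite !expf_neq0// conjC_eq0.
exists f; split=> //.
  by move=> x; exists (root_ideal d (th x.1 x.2)).
move=> x y fxy; apply/eqP; rewrite -subr_eq0; apply/eqP.
(* Multiplicativity suffices: [f (x - y)] and [f 0] are the products of [f x] and of [f y] with
   [f (- y)]. *)
have : f (x - y) = f 0 by rewrite fM fxy -fM subrr.
move: (x - y) => [i j]; rewrite /f /= => fij.
have [|c [Kc c0 cA cVA]] := root_ideal_principal sqf_d (th0 i j) (thI i j) (thF i j).
  by rewrite fij /th !expr0 mulr1.
have ltg (k : 'Z_g) : (k < g)%N by rewrite -[X in (_ < X)%N]Zg ltn_ord.
have z2_gt0 : (0 < z2)%N by exact: leq_trans z2_gt4.
have [A' [e1 [i' [ga [rA' e1_2 ig [Kga ga0] [AE Ai]]]]]] := half _ _ _ _ rA (leq_ltn_trans (leq0n _) z21) A0 (ltg i).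
have [B' [e2 [j' [gb [rB' e2_2 jg [Kgb gb0] [BE Bj]]]]]] := half _ _ _ _ rB z2_gt0 B0 (ltg j).
have A'0 := power_root_neq0 g_gt1 sqf_d n1 rA'.
have B'0 := power_root_neq0 g_gt1 sqf_d n2 rB'.
have [|||| /Ai i0 /Bj j0] := @principal_power_trivial A' B' (c / (ga * gb)) e1 e2 i' j' e1_2 e2_2 rA' rB' ig jg.
- by apply: quad_fieldF => //; exact: quad_fieldM.
- by rewrite mulf_neq0// invr_neq0// mulf_neq0.
- have -> : c / (ga * gb) / (A' ^+ i' * B' ^+ j') = c / th i j; last by [].
  by rewrite /th AE BE; field; rewrite ga0 gb0 !expf_neq0.
- have -> : A' ^+ i' * B' ^+ j' / (c / (ga * gb)) = th i j / c; last by [].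
  by rewrite /th AE BE; field; rewrite c0 ga0 gb0.
by congr (_, _); apply: val_inj.
Qed.

End Embedding.

(** * Local densities *)

(** The quotient [((b + k)^g - b^g) / k] written without division, so that it makes sense at [k = 0]
    and in every ring used below: integers, residues, polynomials. *)
Definition pow_quot (R : comNzRingType) (g : nat) (b k : R) : R :=
  \sum_(i < g) (b + k) ^+ (g.-1 - i) * b ^+ i.

Definition disc_form (R : comNzRingType) (g : nat) (b k s : R) : R :=
  4 * b ^+ g * (2 * s) ^+ g - (k * (2 * s) ^+ g - pow_quot g b k) ^+ 2.

Lemma pow_quotE (R : comNzRingType) g (b k : R) :
  k * pow_quot g b k = (b + k) ^+ g - b ^+ g.
Proof. by rewrite subrXX addrC addKr. Qed.

Lemma rmorph_pow_quot (R S : comNzRingType) (f : {rmorphism R -> S}) g b k :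
  f (pow_quot g b k) = pow_quot g (f b) (f k).
Proof.
rewrite rmorph_sum; apply: eq_bigr => i _.
by rewrite rmorphM !rmorphXn rmorphD.
Qed.

Lemma rmorph_disc_form (R S : comNzRingType) (f : {rmorphism R -> S}) g b k s :
  f (disc_form g b k s) = disc_form g (f b) (f k) (f s).
Proof.
rewrite /disc_form rmorphB !rmorphM /= !rmorphXn rmorphB !rmorphM /= !rmorphXn !rmorphM.
by rewrite rmorph_pow_quot !rmorph_nat.
Qed.

Section RootsModP.
Variable p : nat.
Hypothesis p_pr : prime p.

Let p_gt0 : (0 < p)%N. Proof. exact: prime_gt0. Qed.

Lemma Fp_nat_eq (m n : nat) : (m%:R == n%:R :> 'F_p) = (m == n %[mod p]).
Proof. by rewrite -val_eqE /= !val_Fp_nat. Qed.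

Lemma Fp_int_eq0 (z : int) : (z%:~R == 0 :> 'F_p) = (p %| z)%Z.
Proof.
case: z => n; first by rewrite -pmulrn (Fp_nat_eq n 0) mod0n dvdzE.
by rewrite NegzE rmorphN oppr_eq0 /= -pmulrn (Fp_nat_eq n.+1 0) mod0n dvdzE.
Qed.

Lemma card_roots_Fp (h : {poly 'F_p}) : h != 0 -> (#|[pred r | root h r]| <= (size h).-1)%N.
Proof.
move=> h0; rewrite cardE.
have lt : (size (enum [pred r | root h r]) < size h)%N.
  apply: max_poly_roots => //; last exact: enum_uniq.
  by apply/allP => r; rewrite mem_enum inE.
by rewrite -ltnS (ltn_predK lt).
Qed.

(** The residue modulo [p] and the quotient by [p] determine [s], so each root in [F_p] has at most
    [p] lifts. *)
Lemma card_roots_modp (h : {poly 'F_p}) : h != 0 ->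
  (#|[pred s : 'I_(p ^ 2) | root h (s : nat)%:R]| <= p * (size h).-1)%N.
Proof.
move=> h0; apply: leq_trans (_ : (#|{: 'I_p}| * #|[pred r | root h r]| <= _)%N); last first.
  by rewrite card_ord leq_mul2l card_roots_Fp// orbT.
have divlt (s : 'I_(p ^ 2)) : (s %/ p < p)%N by rewrite ltn_divLR// mulnn.
pose f (s : 'I_(p ^ 2)) := (Ordinal (divlt s), (s : nat)%:R : 'F_p).
have finj : injective f.
  move=> s t [e1 /eqP]; rewrite Fp_nat_eq => /eqP e2; apply: val_inj => /=.
  by rewrite (divn_eq s p) (divn_eq t p) e1 e2.
rewrite -cardX -(card_imset _ finj); apply/subset_leq_card/fintype.subsetP => _ /imsetP[s sr ->].
by rewrite !inE.
Qed.

Lemma poly_taylor1 (f : {poly int}) (x y : int) :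
  exists c : int, f.[x + y] = f.[x] + f^`().[x] * y + c * y ^+ 2.
Proof.
elim/poly_ind: f => [|f a [c cE]].
  by exists 0; rewrite deriv0 !horner0 !mul0r !addr0.
exists (c * (x + y) + f^`().[x]).
rewrite derivD derivM derivX derivC addr0 mulr1 !(hornerD, hornerMX, hornerC) cE; ring.
Qed.

(** The uniqueness half of Hensel's lemma. By Taylor's formula, for two zeros modulo [p^2] that
    agree modulo [p], the difference times a derivative prime to [p] is divisible by [p^2]. *)
Lemma card_simple_roots (f : {poly int}) :
  map_poly intr f != 0 :> {poly 'F_p} ->
  (forall s : nat, (p %| f.[s%:Z])%Z -> ~~ (p %| f^`().[s%:Z])%Z) ->
  (#|[pred s : 'I_(p ^ 2) | ((p ^ 2)%N %| f.[(s : nat)%:Z])%Z]| <=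
    (size (map_poly intr f : {poly 'F_p})).-1)%N.
Proof.
move=> f0 fs; apply: leq_trans (card_roots_Fp f0).
pose h (s : 'I_(p ^ 2)) := (s : nat)%:R : 'F_p.
have dvdp2 (z : int) : ((p ^ 2)%N %| z)%Z -> (p %| z)%Z.
  by apply: dvdz_trans; rewrite dvdzE /= expnS dvdn_mulr.
have dvdp2k (D : int) (k : nat) : ((p ^ 2)%N %| D * (k%:Z * p%:Z))%Z -> (p %| D)%Z || (p %| k)%N.
  by rewrite mulrA !dvdzE !abszM !absz_nat -mulnn dvdn_pmul2r// Euclid_dvdM.
have hinj : {in [pred s : 'I_(p ^ 2) | ((p ^ 2)%N %| f.[(s : nat)%:Z])%Z] &, injective h}.
  move=> s t; wlog st : s t / (s <= t)%N.
    by move=> H sP tP e; case/orP: (leq_total s t) => le; [|apply/esym]; apply: H.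
  rewrite !inE => sP tP /eqP; rewrite Fp_nat_eq => /eqP e; apply: val_inj => /=.
  have /dvdnP[k kE] : (p %| t - s)%N by rewrite -eqn_mod_dvd// eq_sym; apply/eqP.
  have tE : t%:Z = s%:Z + k%:Z * p%:Z by rewrite -PoszM -kE -PoszD subnKC.
  have [c cE] := poly_taylor1 f s (k%:Z * p%:Z).
  have : ((p ^ 2)%N %| f^`().[(s : nat)%:Z] * (k%:Z * p%:Z))%Z.
    have -> : f^`().[(s : nat)%:Z] * (k%:Z * p%:Z) =
      f.[(t : nat)%:Z] - f.[(s : nat)%:Z] - c * (k%:Z * p%:Z) ^+ 2 by rewrite tE cE; ring.
    rewrite rpredB// ?rpredB// dvdz_mull// exprMn dvdz_mull// dvdzE abszX.
  move=> /dvdp2k; rewrite (negPf (fs _ (dvdp2 _ sP))) /= => pk.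
  have : (p ^ 2 %| k * p)%N by rewrite -mulnn dvdn_mul.
  rewrite -kE => dv; apply/eqP; rewrite eqn_leq st /= -subn_eq0 -leqn0 leqNgt.
  apply/negP => /dvdn_leq /(_ dv).
  by rewrite leqNgt (leq_ltn_trans (leq_subr _ _) (ltn_ord t)).
rewrite -(card_in_imset hinj); apply/subset_leq_card/fintype.subsetP => _ /imsetP[s sP ->].
rewrite !inE in sP *; rewrite /root /h -[_%:R]/(((s : nat)%:Z)%:~R) horner_map /=.
by rewrite Fp_int_eq0; exact: dvdp2.
Qed.

End RootsModP.

Section FieldDiscForm.
Variables (F : fieldType) (g : nat).
Hypotheses (g_gt1 : (1 < g)%N) (two0 : 2 != 0 :> F).

Let g_gt0 : (0 < g)%N. Proof. exact: ltnW. Qed.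

Lemma disc_formCX (b k : F) : disc_form g b%:P k%:P 'X =
  (4 * b ^+ g * 2 ^+ g)%:P * 'X^g - ((k * 2 ^+ g)%:P * 'X^g - (pow_quot g b k)%:P) ^+ 2.
Proof.
rewrite /disc_form -(rmorph_pow_quot polyC) exprMn.
by rewrite !(polyCM, polyC_exp) !polyC_natr !mulrA.
Qed.

(** A double zero at [s = 0] means [Q = 0], that is [(b + k)^g = b^g]. Elsewhere it means
    [k (k sg - Q) = 2 b^g]; the vanishing of the form then gives [k^2 sg = b^g], so [k Q = - b^g]
    and [(b + k)^g = 0]. *)
Lemma disc_form_root (b k s : F) : (g%:R != 0 :> F) -> b != 0 -> b + k != 0 ->
  (b + k) ^+ g != b ^+ g ->
  (disc_form g b%:P k%:P 'X).[s] = 0 -> (disc_form g b%:P k%:P 'X)^`().[s] != 0.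
Proof.
move=> g0 b0 bk0 bkg.
have Q0 : pow_quot g b k != 0.
  by apply: contra bkg => /eqP e; rewrite -subr_eq0 -pow_quotE e mulr0.
rewrite -[X in X = 0]/(horner_eval s _) rmorph_disc_form /= /horner_eval !hornerC hornerX.
have -> : (disc_form g b%:P k%:P 'X)^`().[s] =
    (4 * b ^+ g - 2 * k * (k * (2 * s) ^+ g - pow_quot g b k)) * (2 ^+ g * (s ^+ g.-1 * g%:R)).
  rewrite disc_formCX !mul_polyC derivB derivZ expr2 derivM derivB derivZ derivC subr0 derivXn.
  rewrite !(hornerD, hornerN, hornerM, hornerZ, hornerMn, hornerXn, hornerC) exprMn -mulr_natr.
  by ring.
rewrite /disc_form; set Q := pow_quot g b k in Q0 *; set sg := (2 * s) ^+ g => fs.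
rewrite !mulf_eq0 !negb_or expf_neq0// g0 andbT.
have [s0|s0] := eqVneq s 0.
  move: fs; rewrite /sg s0 mulr0 expr0n gtn_eqF// mulr0n !mulr0 !sub0r sqrrN => /eqP.
  by rewrite oppr_eq0 sqrf_eq0 (negPf Q0).
rewrite expf_neq0//= andbT.
apply/negP => /eqP h.
have kQ : k * Q = (b + k) ^+ g - b ^+ g by exact: pow_quotE.
have h2 : k * (k * sg - Q) = 2 * b ^+ g by apply: (mulfI two0); rewrite -[RHS]subr0 -h; ring.
have h3 : 4 * b ^+ g * (k ^+ 2 * sg - b ^+ g) = 0.
  transitivity (4 * b ^+ g * sg * k ^+ 2 - (k * (k * sg - Q)) ^+ 2); first by rewrite h2; ring.
  transitivity (k ^+ 2 * (4 * b ^+ g * sg - (k * sg - Q) ^+ 2)); first by ring.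
  by rewrite fs mulr0.
have four0 : 4 != 0 :> F by rewrite (_ : 4 = 2 * 2) ?mulf_neq0//; ring.
move/eqP: h3; rewrite !mulf_eq0 (negPf four0) expf_eq0 (negPf b0) andbF /= subr_eq0 => /eqP h4.
move: bk0; apply/negP/negPn.
have : (b + k) ^+ g = 0.
  have : k ^+ 2 * sg - k * Q = 2 * b ^+ g by rewrite -h2; ring.
  by rewrite h4 kQ => e; rewrite -[LHS]opprK -[RHS]oppr0; congr (- _); rewrite -[RHS](subrr (2 * b ^+ g)) -{1}e; ring.
by move/eqP; rewrite expf_eq0 => /andP[].
Qed.

(** If the polynomial vanished, its constant term would give [Q = 0], its term in [X^g] would give
    [b = 0], and [k Q = k^g] would give [k = 0]. *)
Lemma disc_form_neq0 (b k : F) : (b != 0) || (k != 0) -> disc_form g b%:P k%:P 'X != 0.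
Proof.
move=> bk; apply/negP => /eqP f0.
have ev s : 4 * b ^+ g * (2 * s) ^+ g - (k * (2 * s) ^+ g - pow_quot g b k) ^+ 2 = 0.
  have := congr1 (horner_eval s) f0; rewrite rmorph_disc_form rmorph0 /= /horner_eval.
  by rewrite !hornerC hornerX.
have Q0 : pow_quot g b k = 0.
  have /eqP := ev 0; rewrite mulr0 expr0n gtn_eqF// mulr0n !mulr0 !sub0r sqrrN oppr_eq0 sqrf_eq0.
  by move/eqP.
have X0 : ('X^g : {poly F}) != 0 by rewrite -size_poly_gt0 size_polyXn.
move: f0; rewrite disc_formCX Q0 subr0 => f0.
have : 'X^g * ((4 * b ^+ g * 2 ^+ g)%:P - ((k * 2 ^+ g) ^+ 2)%:P * 'X^g) = 0.
  by rewrite -f0 polyC_exp; ring.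
move/eqP; rewrite mulf_eq0 (negPf X0) /= => /eqP/(congr1 (horner_eval 0)).
rewrite rmorph0 /= /horner_eval !(hornerD, hornerN, hornerM, hornerXn, hornerC).
rewrite expr0n gtn_eqF// mulr0n mulr0 subr0 => /eqP.
have four0 : 4 != 0 :> F by rewrite (_ : 4 = 2 * 2) ?mulf_neq0//; ring.
rewrite !mulf_eq0 (negPf four0) !expf_eq0 (negPf two0) andbF orbF /= => /andP[_ /eqP b0].
have /eqP := pow_quotE g b k; rewrite Q0 b0 mulr0 add0r expr0n gtn_eqF// mulr0n subr0 eq_sym.
by rewrite expf_eq0 => /andP[_ /eqP k0]; move: bk; rewrite b0 k0 eqxx.
Qed.

Lemma size_disc_form (b k : F) : (size (disc_form g b%:P k%:P 'X) <= (2 * g).+1)%N.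
Proof.
rewrite disc_formCX.
have mono (c : F) n : (size (c%:P * 'X^n)%R <= n.+1)%N.
  by rewrite mul_polyC (leq_trans (size_scale_leq _ _))// size_polyXn.
apply: leq_trans (size_polyD _ _) _; rewrite geq_max size_polyN; apply/andP; split.
  by apply: leq_trans (mono _ _) _; rewrite ltnS leq_pmull.
apply: leq_trans (size_poly_exp_leq _ _) _; rewrite ltnS.
have : (size ((k * 2 ^+ g)%:P * 'X^g - (pow_quot g b k)%:P)%R <= g.+1)%N.
  apply: leq_trans (size_polyD _ _) _; rewrite geq_max mono size_polyN.
  by rewrite (leq_trans (size_polyC_leq1 _)).
by move: (size _) => n; clear; lia.
Qed.

Lemma bad_pairs_poly (b : F) : 
  exists2 h : {poly F}, h != 0 /\ (size h <= g.+2)%N &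
    forall k, (b + k == 0) || ((b + k) ^+ g == b ^+ g) -> root h k.
Proof.
pose u : {poly F} := 'X + b%:P.
have su n : size (u ^+ n) = n.+1 by rewrite /u -[b]opprK polyCN size_exp_XsubC.
have sv : size (u ^+ g - (b ^+ g)%:P) = g.+1.
  rewrite size_polyDl su// size_polyN (leq_ltn_trans (size_polyC_leq1 _))//.
exists (u * (u ^+ g - (b ^+ g)%:P)).
  have u0 : u != 0 by rewrite -size_poly_gt0 size_XaddC.
  have v0 : u ^+ g - (b ^+ g)%:P != 0 by rewrite -size_poly_gt0 sv.
  by rewrite mulf_neq0// size_mul// sv size_XaddC.
move=> k /orP h; rewrite rootM /root !(hornerD, horner_exp, hornerN, hornerC, hornerX) addrC.
by rewrite subr_eq0; case: h => ->; rewrite ?orbT.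
Qed.

End FieldDiscForm.

Section LocalCount.
Variables (g p : nat).
Hypotheses (g_gt1 : (1 < g)%N) (p_pr : prime p) (p_gt2g : (2 * g < p)%N).

Let p_gt0 : (0 < p)%N. Proof. exact: prime_gt0. Qed.

Lemma Fp_nat_neq0 n : (0 < n < p)%N -> n%:R != 0 :> 'F_p.
Proof. by case/andP=> n0 np; rewrite (Fp_nat_eq p_pr n 0) mod0n modn_small// -lt0n. Qed.

Let two0 : 2 != 0 :> 'F_p. Proof. by apply: (@Fp_nat_neq0 2); clear -g_gt1 p_gt2g; lia. Qed.
Let g0 : g%:R != 0 :> 'F_p. Proof. by apply: Fp_nat_neq0; clear -g_gt1 p_gt2g; lia. Qed.

Let bad (b k : nat) : bool := let b' := b%:R : 'F_p in let k' := k%:R : 'F_p in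
  [|| b' == 0, b' + k' == 0 | (b' + k') ^+ g == b' ^+ g].

Let zp (b : nat) : bool := b%:R == 0 :> 'F_p.

Let both (b k : nat) : bool := zp b && zp k.

(** If [b] and [k] both vanish modulo [p], nothing is claimed beyond the trivial [p^2]. For the
    other bad pairs each of the at most [2 g] roots modulo [p] may have [p] lifts; for good pairs
    all roots are simple and lift at most once. *)
Lemma disc_form_card_s (b k : nat) :
  (#|[pred s : 'I_(p ^ 2) | ((p ^ 2)%N %| disc_form g b%:Z k%:Z (s : nat)%:Z)%Z]|
    <= both b k * p ^ 2 + (bad b k * (p * (2 * g)) + 2 * g))%N.
Proof.
have [bo|nbo] := boolP (both b k).
  by apply: leq_trans (max_card _) _; rewrite card_ord mul1n leq_addr.
rewrite mul0n add0n.
pose f : {poly int} := disc_form g b%:Z%:P k%:Z%:P 'X.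
pose fp : {poly 'F_p} := disc_form g b%:R%:P k%:R%:P 'X.
have fE s : f.[s] = disc_form g b%:Z k%:Z s.
  by rewrite -/(horner_eval s f) rmorph_disc_form /= /horner_eval !hornerC hornerX.
have fpE : map_poly intr f = fp by rewrite rmorph_disc_form /= !map_polyC map_polyX.
have fp0 : fp != 0.
  by apply: disc_form_neq0; rewrite // -negb_and.
have sfp : ((size fp).-1 <= 2 * g)%N.
  by rewrite -ltnS prednK ?size_poly_gt0// (leq_trans (size_disc_form _ _ _)).
have [ba|nba] := boolP (bad b k).
  rewrite mul1n; apply: leq_trans (leq_addr _ _).
  apply: leq_trans (leq_trans (card_roots_modp p_pr fp0) _); last by rewrite leq_mul2l sfp orbT.
  apply/subset_leq_card/fintype.subsetP => s; rewrite !inE -fE => dv.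
  rewrite /root -fpE -[_%:R]/(((s : nat)%:Z)%:~R) horner_map /= Fp_int_eq0//.
  by apply: dvdz_trans dv; rewrite dvdzE /= -mulnn dvdn_mulr.
rewrite mul0n add0n.
move: nba; rewrite /bad !negb_or => /and3P[b0 bk0 bkg].
apply: leq_trans sfp; rewrite -fpE.
rewrite (@eq_card _ _ [pred s : 'I_(p ^ 2) | ((p ^ 2)%N %| f.[(s : nat)%:Z])%Z]); last first.
  by move=> s; rewrite !inE fE.
apply: card_simple_roots; rewrite ?fpE//.
move=> s; rewrite -!Fp_int_eq0// -!horner_map /= -deriv_map fpE => /eqP fs0.
exact: disc_form_root fs0.
Qed.

Lemma zero_count : (\sum_(b : 'I_(p ^ 2)) zp b <= p)%N.
Proof.
have X0 : ('X : {poly 'F_p}) != 0 by rewrite polyX_eq0.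
have := card_roots_modp p_pr X0; rewrite size_polyX muln1; apply: leq_trans.
rewrite -sum1_card [X in (_ <= X)%N]big_mkcond /=; apply: leq_sum => b _.
by rewrite inE /root hornerX /zp; case: eqP.
Qed.

Lemma bad_count :
  (\sum_(b : 'I_(p ^ 2)) \sum_(k : 'I_(p ^ 2)) bad b k <= g.+2 * p ^ 3)%N.
Proof.
pose q := (p ^ 2)%N.
apply: (@leq_trans (\sum_(b : 'I_q) zp b * q +
    \sum_(b : 'I_q) (p * g.+1))%N).
  rewrite -big_split /=; apply: leq_sum => b _.
  have [b0|b0] := boolP (zp b).
    apply: leq_trans (leq_addr _ _); rewrite mul1n -[X in (_ <= X)%N]card_ord -sum1_card.
    by apply: leq_sum => k _; case: (bad _ _).
  rewrite mul0n add0n.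
  have [h [h0 hs] hP] := bad_pairs_poly g_gt1 ((b : nat)%:R : 'F_p).
  apply: leq_trans (leq_trans (card_roots_modp p_pr h0) _); last first.
    by rewrite leq_mul2l -ltnS prednK ?size_poly_gt0// hs orbT.
  rewrite -sum1_card [X in (_ <= X)%N]big_mkcond /=; apply: leq_sum => k _.
  rewrite inE /bad -/(zp b) (negPf b0) /=.
  by case: ifP => [_|/negP nr]; [case: (_ || _)|rewrite leqn0 eqb0; apply/negP => /hP].
rewrite -big_distrl sum_nat_const card_ord /=.
apply: (@leq_trans (p * q + q * (p * g.+1))%N); last first.
  by rewrite /q [X in (_ <= X)%N](_ : _ = p * p ^ 2 + p ^ 2 * (p * g.+1))%N//; ring.
by rewrite leq_add2r leq_mul2r zero_count orbT.
Qed.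

Lemma both_count :
  (\sum_(b : 'I_(p ^ 2)) \sum_(k : 'I_(p ^ 2)) both b k <= p ^ 2)%N.
Proof.
rewrite (eq_bigr (fun b : 'I_(p ^ 2) => zp b *
  \sum_(k : 'I_(p ^ 2)) zp k)%N); last first.
  by move=> b _; rewrite big_distrr /=; apply: eq_bigr => k _; rewrite mulnb.
by rewrite -big_distrl /= -mulnn leq_mul// zero_count.
Qed.

(** All three classes contribute the order [p^4]: [p^2] pairs with [p^2] zeros, [O(p^3)] pairs with
    [O(p)] zeros, and [p^4] pairs with [O(1)] zeros. *)
Lemma disc_form_card :
  (\sum_(b : 'I_(p ^ 2)) \sum_(k : 'I_(p ^ 2))
    #|[pred s : 'I_(p ^ 2) | ((p ^ 2)%N %| disc_form g (b : nat)%:Z (k : nat)%:Z (s : nat)%:Z)%Z]|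
    <= (1 + g.+2 * (2 * g) + 2 * g) * p ^ 4)%N.
Proof.
pose R := (\sum_(b : 'I_(p ^ 2)) \sum_(k : 'I_(p ^ 2))
   (both b k * p ^ 2 + (bad b k * (p * (2 * g)) + 2 * g)))%N.
apply: (@leq_trans R).
  by apply: leq_sum => b _; apply: leq_sum => k _; exact: disc_form_card_s.
rewrite /R; clear R; move: (2 * g)%N (g.+2) both_count bad_count => G h bo ba.
under eq_bigr => b _ do rewrite 2!big_split /= -!big_distrl sum_nat_const card_ord.
rewrite 2!big_split /= -!big_distrl sum_nat_const card_ord /=.
have p4 : (p ^ 2 * p * p * G = G * p ^ 4)%N by ring.
rewrite p4 !mulnDl addnA leq_add2r leq_add//.
  by rewrite mul1n (_ : p ^ 4 = p ^ 2 * p ^ 2)%N ?leq_mul2r ?bo ?orbT// -expnD.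
by rewrite (_ : h * G * p ^ 4 = h * p ^ 3 * (p * G))%N ?leq_mul2r ?ba ?orbT//; ring.
Qed.

End LocalCount.

(** * The form as a polynomial in three variables, and its constant *)

Definition disc_mpoly (g : nat) : mpoly.mpoly 3 int :=
  let X (i : 'I_3) : mpoly.mpoly 3 int := mpoly.mpolyX int (mpoly.mnm1 i) in
  disc_form g (X (@Ordinal 3 0 isT)) (X (@Ordinal 3 1 isT)) (X (@Ordinal 3 2 isT)).

Lemma meval_disc_mpoly g (v : 'I_3 -> int) :
  mpoly.meval v (disc_mpoly g) = disc_form g (v (@Ordinal 3 0 isT)) (v (@Ordinal 3 1 isT)) (v (@Ordinal 3 2 isT)).
Proof. by rewrite rmorph_disc_form /= !mpoly.mevalXU. Qed.

Lemma meval_map_disc_mpoly (S : comNzRingType) g (v : 'I_3 -> S) :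
  mpoly.meval v (mpoly.map_mpoly (fun z : int => z%:~R) (disc_mpoly g)) =
  disc_form g (v (@Ordinal 3 0 isT)) (v (@Ordinal 3 1 isT)) (v (@Ordinal 3 2 isT)).
Proof.
rewrite -[LHS]/((mpoly.meval v \o mpoly.map_mpoly intr) (disc_mpoly g)).
by rewrite rmorph_disc_form /= !mpoly.map_mpolyX !mpoly.mevalXU.
Qed.

Lemma pow_quot0 (S : comNzRingType) g (t : S) : pow_quot g.+1 0 t = t ^+ g.
Proof.
rewrite /pow_quot big_ord_recl /= subn0 expr0 mulr1 add0r big1 ?addr0// => i _.
by rewrite expr0n mulr0.
Qed.

Lemma disc_form_0t0 (S : comNzRingType) g (t : S) :
  disc_form g.+1 0 t 0 = - (t ^+ g) ^+ 2.
Proof. by rewrite /disc_form pow_quot0 mulr0 expr0n !mulr0 !sub0r sqrrN. Qed.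

(** A polynomial of degree at most 1 is affine along the [k]-axis; three values therefore detect
    that [disc_mpoly] has degree at least 2. *)
Lemma meval_second_difference (P : mpoly.mpoly 3 int) (v : int -> 'I_3 -> int) :
  (forall t i, v t i = if (i == 1%N :> nat) then t else 0) ->
  (mpoly.msize P <= 2)%N ->
  mpoly.meval (v 2) P - 2 * mpoly.meval (v 1) P + mpoly.meval (v 0) P = 0.
Proof.
move=> vE sz; rewrite !mpoly.mevalE mulr_sumr -sumrB -big_split /= big_seq big1// => m mP.
have m1 : (mpoly.fun_of_multinom m (@Ordinal 3 1 isT) <= 1)%N.
  have := leq_trans (mpoly.msize_mdeg_lt mP) sz; rewrite ltnS; apply: leq_trans.
  by rewrite mpoly.mdegE (bigD1 (@Ordinal 3 1 isT))//= leq_addr.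
have prodE t : \prod_(i < 3) v t i ^+ mpoly.fun_of_multinom m i =
    0 ^+ mpoly.fun_of_multinom m (@Ordinal 3 0 isT) * 0 ^+ mpoly.fun_of_multinom m (@Ordinal 3 2 isT)
    * t ^+ mpoly.fun_of_multinom m (@Ordinal 3 1 isT).
  rewrite 3!big_ord_recl big_ord0 mulr1 !vE /= [X in _ * X]mulrC mulrA.
  by congr (_ ^+ mpoly.fun_of_multinom m _ * _ ^+ mpoly.fun_of_multinom m _ * _ ^+ mpoly.fun_of_multinom m _); apply: val_inj.
rewrite !prodE; move: m1 (_ * 0 ^+ _) => + c.
by case: (mpoly.fun_of_multinom _ _) => [|[]//] _; rewrite ?expr0 ?expr1; ring.
Qed.

Lemma msize_disc_mpoly g : (1 < g)%N -> (2 <= (mpoly.msize (disc_mpoly g)).-1)%N.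
Proof.
case: g => [|[|g]]// _; rewrite leqNgt; apply/negP => sz.
pose v (t : int) (i : 'I_3) : int := if (i == 1%N :> nat) then t else 0.
have := @meval_second_difference (disc_mpoly g.+2) v (fun _ _ => erefl).
rewrite !meval_disc_mpoly /v /= !disc_form_0t0 expr0n /= expr1n.
have /[swap] /[apply] : (mpoly.msize (disc_mpoly g.+2) <= 2)%N by move: sz; case: (mpoly.msize _).
have : 1 <= 2 ^+ g :> int by rewrite exprn_ege1.
by rewrite (exprS 2 g) !expr2; move: (2 ^+ g) => y; clear; nia.
Qed.

Lemma Zp_int_eq0 (q : nat) (z : int) : (1 < q)%N -> z%:~R = 0 :> 'Z_q -> (q %| z)%Z.
Proof.
move=> q1; case: z => n.
  by rewrite -pmulrn => /(congr1 val); rewrite /= val_Zp_nat// dvdzE => /eqP.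
rewrite NegzE rmorphN /= -pmulrn => /eqP; rewrite oppr_eq0 => /eqP /(congr1 val).
by rewrite /= val_Zp_nat// dvdzE => /eqP.
Qed.

Lemma rho_disc_mpoly_lt (g q : nat) : (0 < g)%N -> (1 < q)%N -> (rho (disc_mpoly g) q < q ^ 3)%N.
Proof.
move=> g0 q1.
have -> : (q ^ 3 = #|{ffun 'I_3 -> 'Z_q}|)%N by rewrite card_ffun !card_ord Zp_cast.
rewrite ltnNge; apply/negP => h.
pose x : {ffun 'I_3 -> 'Z_q} := [ffun i : 'I_3 => if (i == 1%N :> nat) then 1 else 0].
have : [pred x : {ffun 'I_3 -> 'Z_q} | mpoly.meval x (mpoly.map_mpoly (fun z : int => z%:~R : 'Z_q) (disc_mpoly g)) == 0] =i predT.
  by apply/subset_cardP; [apply/eqP; rewrite eqn_leq h max_card|exact: subset_predT].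
move/(_ x); rewrite !inE meval_map_disc_mpoly !ffunE /=.
by case: g g0 {h} => // g _; rewrite disc_form_0t0 !expr1n oppr_eq0 oner_eq0.
Qed.

Lemma rho_disc_mpoly_le (g p : nat) : (1 < g)%N -> prime p -> (2 * g < p)%N ->
  (rho (disc_mpoly g) (p ^ 2) <= (1 + g.+2 * (2 * g) + 2 * g) * p ^ 4)%N.
Proof.
move=> g1 pp pg; apply: leq_trans (disc_form_card g1 pp pg).
have q1 : (1 < p ^ 2)%N by rewrite (@ltn_exp2l _ 0)// prime_gt1.
have Zq : (Zp_trunc (p ^ 2)).+2 = (p ^ 2)%N by exact: Zp_cast.
pose o (y : 'Z_(p ^ 2)) : 'I_(p ^ 2) := cast_ord Zq y.
pose h (x : {ffun 'I_3 -> 'Z_(p ^ 2)}) := (o (x (@Ordinal 3 0 isT)), o (x (@Ordinal 3 1 isT)), o (x (@Ordinal 3 2 isT))).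
have hinj : injective h.
  move=> x y [/val_inj e0 /val_inj e1 /val_inj e2]; apply/ffunP => -[[|[|[|//]]] lt].
  - by rewrite (_ : Ordinal lt = @Ordinal 3 0 isT)//; exact: val_inj.
  - by rewrite (_ : Ordinal lt = @Ordinal 3 1 isT)//; exact: val_inj.
  - by rewrite (_ : Ordinal lt = @Ordinal 3 2 isT)//; exact: val_inj.
rewrite pair_big /=.
under [X in (_ <= X)%N]eq_bigr => t _ do rewrite -sum1_card.
rewrite pair_big_dep /= sum1_card /rho -(card_imset _ hinj).
apply/subset_leq_card/fintype.subsetP => _ /imsetP[x xP ->].
rewrite !inE /= in xP *; move/eqP: xP; rewrite meval_map_disc_mpoly => e.
have oE (y : 'Z_(p ^ 2)) : ((y : nat)%:Z)%:~R = y by rewrite -pmulrn; exact: natr_Zp.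
by apply: (Zp_int_eq0 q1); rewrite rmorph_disc_form /= !oE e.
Qed.

(** The tail of the product is kept above 1/2 by the stronger claim [1/2 + K / (M - 1)], which
    survives multiplication by [1 - K / M^2] because [K / (M - 1) - K / M >= K / M^2]. The start
    [N0 = 2 K + 2] makes this claim at most 1. *)
Lemma lim_prod_gt0 (R : realType) (P : pred nat) (a : nat -> R) (K : nat) :
  (forall n, P n -> 0 < a n <= 1) ->
  (forall n, P n -> (K < n)%N -> 1 - K%:R / n%:R ^+ 2 <= a n) ->
  0 < limn (fun N : nat => \prod_(n < N | P n) a n).
Proof.
move=> a01 aK; set u := (X in limn X).
have uS N : u N.+1 = u N * (if P N then a N else 1).
  by rewrite /u big_mkcond big_ord_recr /= -big_mkcond.
have u_gt0 N : 0 < u N by apply: prodr_gt0 => n /a01/andP[].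
have step N : 0 < (if P N then a N else 1) <= 1.
  by case: ifP => [/a01//|]; rewrite ltr01 lexx.
have udec : nonincreasing_seq u.
  apply/nonincreasing_seqP => N; rewrite uS ger_pMr//.
  by have /andP[] := step N.
pose N0 := (2 * K).+2.
have N0_gt0 : 0 < (N0.-1)%:R :> R by rewrite ltr0n.
have low n : u N0 * (2^-1 + K%:R / (N0 + n).-1%:R) <= u (N0 + n)%N.
  elim: n => [|n IH].
    rewrite addn0 ger_pMr// -[X in _ <= X](_ : 2^-1 + 2^-1 = 1); last by lra.
    rewrite lerD2l ler_pdivrMr// (_ : N0.-1 = 2 * K + 1)%N ?natrD ?natrM; [lra|rewrite /N0; lia].
  rewrite addnS uS.
  set M := (N0 + n)%N in IH *.
  have M1 : (K < M)%N by rewrite /M /N0; lia.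
  have M_gt1 : (1 < M)%N by rewrite /M /N0; lia.
  have m_gt0 : 0 < M.-1%:R :> R by rewrite ltr0n -ltnS prednK// ltnW.
  have M_gt0 : 0 < M%:R :> R by rewrite ltr0n ltnW.
  have ME : M%:R = M.-1%:R + 1 :> R by rewrite natr1 prednK// ltnW.
  have {}aK : 1 - K%:R / M%:R ^+ 2 <= if P M then a M else 1.
    case: ifP => [PM|_]; first exact: aK.
    by rewrite gerBl divr_ge0// ?ler0n ?exprn_ge0 ?ler0n.
  apply: le_trans (ler_pM _ _ IH aK).
  - rewrite -mulrA ler_pM2l//= -/M.
    have : 2^-1 + K%:R / M.-1%:R <= 1 :> R.
      rewrite -[X in _ <= X](_ : 2^-1 + 2^-1 = 1); last by lra.
      by rewrite lerD2l ler_pdivrMr// mulrC ler_pdivlMr// -natrM ler_nat /M /N0; lia.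
    have : K%:R / M.-1%:R - K%:R / M%:R - K%:R / M%:R ^+ 2 = K%:R / (M.-1%:R * M%:R ^+ 2) :> R.
      by rewrite ME; field; rewrite -ME !gt_eqF.
    have : 0 <= K%:R / (M.-1%:R * M%:R ^+ 2) :> R by rewrite divr_ge0// mulr_ge0// exprn_ge0// ltW.
    have : 0 <= K%:R / M%:R ^+ 2 :> R by rewrite divr_ge0// exprn_ge0// ltW.
    move: (K%:R / M.-1%:R) (K%:R / M%:R) (K%:R / M%:R ^+ 2) (K%:R / (M.-1%:R * M%:R ^+ 2)).
    by move=> x z y w; clear; nra.
  - by rewrite mulr_ge0 ?addr_ge0 ?divr_ge0 ?invr_ge0 ?ler0n// ltW.
  - rewrite subr_ge0 ler_pdivrMr ?exprn_gt0// mul1r -natrX ler_nat.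
    by rewrite (leq_trans (ltnW M1))// -mulnn leq_pmulr// ltnW.
apply: (@lt_le_trans _ _ (u N0 * 2^-1)); first by rewrite mulr_gt0// invr_gt0.
have ulb N : u N0 * 2^-1 <= u N.
  have [NN|NN] := leqP N0 N.
    rewrite -(subnKC NN); apply: le_trans (low _).
    by rewrite ler_pM2l// lerDl divr_ge0.
  apply: le_trans (udec _ _ (ltnW NN)).
  by rewrite ger_pMr// invf_le1// ler1n.
apply: limr_ge; last by exact: nearW.
apply: nonincreasing_is_cvgn => //.
by exists (u N0 * 2^-1) => _ [N _ <-].
Qed.

Lemma sqf_constant_disc_gt0 (R : realType) (g : nat) : (1 < g)%N ->
  0 < sqf_constant R (disc_mpoly g).
Proof.
move=> g1; apply: (@lim_prod_gt0 _ prime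
  (fun p => 1 - (rho (disc_mpoly g) (p ^ 2))%:R / p%:R ^+ (2 * 3)) (1 + g.+2 * (2 * g) + 2 * g)).
  move=> p pp; have p0 : 0 < (p%:R : R) by rewrite ltr0n prime_gt0.
  have lt : (rho (disc_mpoly g) (p ^ 2) < (p ^ 2) ^ 3)%N.
    by apply: rho_disc_mpoly_lt; [exact: ltnW|rewrite (@ltn_exp2l _ 0)// prime_gt1].
  rewrite subr_gt0 ltr_pdivrMr ?exprn_gt0// mul1r -natrX ltr_nat expnM lt /=.
  by rewrite gerBl divr_ge0// ?exprn_ge0// ler0n.
move=> p pp pK; have p0 : 0 < (p%:R : R) by rewrite ltr0n prime_gt0.
rewrite lerD2l lerN2 ler_pdivrMr ?exprn_gt0//.
rewrite (_ : 2 * 3 = 2 + 4)%N// exprD mulrA divfK ?expf_neq0 ?gt_eqF// -natrX -natrM ler_nat.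
apply: rho_disc_mpoly_le => //; apply: leq_ltn_trans pK; exact: leq_addl.
Qed.

(** * The region where d is large *)

Lemma pow_quot_ge0 g (b k : int) : 0 <= b -> 0 <= k -> 0 <= pow_quot g b k.
Proof.
by move=> b0 k0; apply: sumr_ge0 => i _; rewrite mulr_ge0 ?exprn_ge0 ?addr_ge0.
Qed.

Lemma pow_quot_le g (b k : int) : 0 <= b -> 0 <= k ->
  pow_quot g b k <= g%:Z * (b + k) ^+ g.-1.
Proof.
move=> b0 k0; rewrite /pow_quot.
apply: (@le_trans _ _ (\sum_(i < g) (b + k) ^+ g.-1)); last first.
  by rewrite sumr_const card_ord -mulr_natl natz.
apply: ler_sum => -[i /= ig] _.
have -> : (b + k) ^+ g.-1 = (b + k) ^+ (g.-1 - i) * (b + k) ^+ i.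
  by rewrite -exprD subnK//; case: g ig.
by rewrite ler_wpM2l ?exprn_ge0 ?addr_ge0// lerXn2r ?nnegrE ?addr_ge0// lerDl.
Qed.

Lemma subrXX_le n (x y : int) : 0 <= x -> x <= y ->
  y ^+ n.+1 - x ^+ n.+1 <= (y - x) * (n.+1%:Z * y ^+ n).
Proof.
move=> x0 xy; rewrite subrXX ler_wpM2l ?subr_ge0//.
have -> : n.+1%:Z * y ^+ n = \sum_(i < n.+1) y ^+ n by rewrite sumr_const card_ord -mulr_natl natz.
apply: ler_sum => -[i /= il] _.
rewrite -[X in _ <= y ^+ X](subnK (n := n) (m := i))// exprD ler_wpM2l ?exprn_ge0 ?(le_trans x0)//.
by rewrite lerXn2r ?nnegrE// (le_trans x0).
Qed.

(** A mean value bound on each of the [g] summands. It serves to compare the variation of [Q] with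
    that of [k sg]. *)
Lemma pow_quot_incr g (b k k' : int) : (1 < g)%N -> 0 <= b -> 0 <= k -> k <= k' ->
  pow_quot g b k' - pow_quot g b k <= (k' - k) * (g%:Z ^+ 2 * (b + k') ^+ (g - 2)).
Proof.
move=> g1 b0 k0 kk'; rewrite /pow_quot -sumrB.
have k'0 : 0 <= k' by exact: le_trans kk'.
have -> : (k' - k) * (g%:Z ^+ 2 * (b + k') ^+ (g - 2)) =
    \sum_(i < g) (k' - k) * (g%:Z * (b + k') ^+ (g - 2)).
  by rewrite sumr_const card_ord -mulr_natl natz; ring.
apply: ler_sum => -[i /= ig] _; rewrite -mulrBl.
case n0 : (g.-1 - i)%N => [|n].
  by rewrite subrr mul0r !mulr_ge0 ?subr_ge0// exprn_ge0// addr_ge0.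
have -> : (g - 2 = n + i)%N by clear -n0 g1 ig; lia.
rewrite exprD.
have h1 := @subrXX_le n (b + k) (b + k') (addr_ge0 b0 k0) ltac:(by rewrite lerD2l).
have h2 : b ^+ i <= (b + k') ^+ i by rewrite lerXn2r ?nnegrE ?addr_ge0// lerDl.
apply: le_trans (ler_pM _ _ h1 h2) _.
- by rewrite subr_ge0 lerXn2r ?nnegrE ?addr_ge0// lerD2l.
- by rewrite exprn_ge0.
rewrite (_ : b + k' - (b + k) = k' - k); last by ring.
rewrite -!mulrA ler_wpM2l ?subr_ge0// ler_wpM2r ?mulr_ge0 ?exprn_ge0 ?addr_ge0//.
by rewrite lez_nat; clear -n0 ig; lia.
Qed.

Lemma sqr_sub_le (x y z : int) : 0 <= x -> 0 <= y -> x ^+ 2 <= z -> y ^+ 2 <= z ->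
  (x - y) ^+ 2 <= z.
Proof. by move=> x0 y0 xz yz; case: (lerP x y) => h; nra. Qed.

Section Region.
Variables (g : nat) (b k sg : int).
Hypotheses (g_gt1 : (1 < g)%N) (b_gt0 : 0 < b) (k_ge0 : 0 <= k).
Hypotheses (sg_ge : 4 * g%:Z ^+ 2 * b ^+ (g - 2) <= sg) (sg_le : k ^+ 2 * sg <= b ^+ g).

Let b_ge0 : 0 <= b. Proof. exact: ltW. Qed.
Let gpos : 0 < g%:Z. Proof. by rewrite ltz_nat ltnW. Qed.

Lemma region_sg_gt0 : 0 < sg.
Proof.
by apply: lt_le_trans sg_ge; rewrite !mulr_gt0// exprn_gt0.
Qed.

Lemma region_k_small : 2 * g%:Z * k <= b.
Proof.
have h : (2 * g%:Z * k) ^+ 2 * b ^+ (g - 2) <= b ^+ 2 * b ^+ (g - 2).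
  rewrite -exprD subnKC//; apply: le_trans sg_le.
  rewrite [X in X <= _](_ : _ = k ^+ 2 * (4 * g%:Z ^+ 2 * b ^+ (g - 2))); last by ring.
  by rewrite ler_wpM2l// sqr_ge0.
by move: h; rewrite ler_pM2r ?exprn_gt0// ler_pXn2r ?nnegrE// !mulr_ge0//.
Qed.

(** Since [2 g k <= b], the difference [(b + k)^g - b^g = k Q] is at most [g k (b + k)^(g-1)], hence
    at most half of [(b + k)^g]. Smaller exponents follow by monotonicity. *)
Lemma region_pow m : (m <= g)%N -> (b + k) ^+ m <= 2 * b ^+ m.
Proof.
have a0 : 0 <= b + k by rewrite addr_ge0.
have hg : (b + k) ^+ g <= 2 * b ^+ g.
  have h1 := pow_quotE g b k.
  have h2 : k * pow_quot g b k <= k * (g%:Z * (b + k) ^+ g.-1).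
    by rewrite ler_wpM2l// pow_quot_le.
  have h3 : 2 * g%:Z * k * (b + k) ^+ g.-1 <= (b + k) * (b + k) ^+ g.-1.
    by rewrite ler_wpM2r ?exprn_ge0// (le_trans region_k_small)// lerDl.
  have h4 : (b + k) * (b + k) ^+ g.-1 = (b + k) ^+ g by rewrite -exprS prednK// ltnW.
  move: h1 h2 h3 h4; move: ((b + k) ^+ g) ((b + k) ^+ g.-1) (b ^+ g) (pow_quot g b k).
  by clear => A A' B Q h1 h2 h3 h4; nra.
move=> mg; rewrite -(ler_pM2r (exprn_gt0 (g - m) b_gt0)) -mulrA -exprD subnKC//.
apply: le_trans hg; rewrite -[X in _ <= _ ^+ X](subnKC mg) exprD.
by rewrite ler_wpM2l ?exprn_ge0// lerXn2r ?nnegrE// lerDl.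
Qed.

(** Both [k sg] and [Q] are nonnegative with square at most [b^g sg], and so is the square of their
    difference. The lower bound on [sg] is made for [Q <= 2 g b^(g-1)]. *)
Lemma region_trace : (k * sg - pow_quot g b k) ^+ 2 <= b ^+ g * sg.
Proof.
have sg0 := region_sg_gt0.
have Q0 := pow_quot_ge0 g b_ge0 k_ge0.
have Q2 : pow_quot g b k ^+ 2 <= b ^+ g * sg.
  have Q1 : pow_quot g b k <= 2 * g%:Z * b ^+ g.-1.
    apply: le_trans (pow_quot_le g b_ge0 k_ge0) _.
    rewrite (_ : 2 * g%:Z * b ^+ g.-1 = g%:Z * (2 * b ^+ g.-1)); last by ring.
    by rewrite ler_wpM2l ?region_pow ?leq_pred// ltW.
  apply: (@le_trans _ _ ((2 * g%:Z * b ^+ g.-1) ^+ 2)).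
    by rewrite lerXn2r ?nnegrE// (le_trans Q0).
  rewrite [X in X <= _](_ : _ = b ^+ g * (4 * g%:Z ^+ 2 * b ^+ (g - 2))).
    by rewrite ler_wpM2l// exprn_ge0.
  rewrite exprMn -exprM mulrCA -exprD; congr (_ * _); first by ring.
  by congr (_ ^+ _); clear -g_gt1; lia.
have K2 : (k * sg) ^+ 2 <= b ^+ g * sg.
  by rewrite exprMn expr2 mulrA ler_wpM2r// ltW.
have ks0 : 0 <= k * sg by rewrite mulr_ge0// ltW.
exact: sqr_sub_le.
Qed.

End Region.

(** The slope of [Q] in [k] is at most [g^2 (b + k')^(g-2) <= 2 g^2 b^(g-2)], which is less than
    [sg]. *)
Lemma region_trace_inj g (b k k' sg : int) : (1 < g)%N -> 0 < b -> 0 <= k -> k < k' ->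
  4 * g%:Z ^+ 2 * b ^+ (g - 2) <= sg -> k' ^+ 2 * sg <= b ^+ g ->
  k * sg - pow_quot g b k < k' * sg - pow_quot g b k'.
Proof.
move=> g1 b0 k0 kk' s1 s2.
have k'0 : 0 <= k' by exact: le_trans (ltW kk').
have h := pow_quot_incr g1 (ltW b0) k0 (ltW kk').
have h2 := region_pow g1 b0 k'0 s1 s2 (leq_subr 2 g).
have h3 : (k' - k) * (g%:Z ^+ 2 * (b + k') ^+ (g - 2)) <
    (k' - k) * sg.
  rewrite ltr_pM2l ?subr_gt0//; apply: lt_le_trans s1.
  have g2 : 0 < g%:Z ^+ 2 by rewrite exprn_gt0// ltz_nat ltnW.
  have bg : 0 < b ^+ (g - 2) by rewrite exprn_gt0.
  apply: le_lt_trans (ler_wpM2l (ltW g2) h2) _.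
  by move: (g%:Z ^+ 2) (b ^+ (g - 2)) g2 bg; clear => G B; nra.
by move: h h3; move: (pow_quot g b k) (pow_quot g b k') (_ * (b + k') ^+ _); clear => Q Q' z; lra.
Qed.

Lemma Posz_exp (m n : nat) : (m ^ n)%N%:Z = m%:Z ^+ n.
Proof. by rewrite -natz natrX natz. Qed.

(* The last two inequalities give [(k sg - Q)^2 <= b^g sg], hence
   [3 b^g sg <= d <= 4 b^g sg], where [sg = (2 s)^g]. *)
Definition in_region (g b k s : nat) : bool :=
  [&& (2 ^ g < b)%N, (4 * g ^ 2 * b ^ (g - 2) <= (2 * s) ^ g)%N
    & (k ^ 2 * (2 * s) ^ g <= b ^ g)%N].

Definition trace2 (g b k s : nat) : int :=
  k%:Z * (2 * s%:Z) ^+ g - pow_quot g b%:Z k%:Z.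

Lemma disc_form_trace2 g (b k s : nat) :
  disc_form g b%:Z k%:Z s%:Z = 4 * (b%:Z * (2 * s%:Z)) ^+ g - trace2 g b k s ^+ 2.
Proof. by rewrite /disc_form /trace2 [(b%:Z * _) ^+ g]exprMn mulrA. Qed.

Section RegionNat.
Variables (g b k s : nat).
Hypotheses (g_gt1 : (1 < g)%N) (reg : in_region g b k s).

Let b_gt : (2 ^ g < b)%N. Proof. by case/and3P: reg. Qed.
Let b_gt0 : 0 < b%:Z. Proof. by rewrite ltz_nat (leq_ltn_trans _ b_gt). Qed.
Let sgE : (2 * s%:Z) ^+ g = ((2 * s) ^ g)%N%:Z. Proof. by rewrite Posz_exp PoszM. Qed.

Lemma region_sg_ge : 4 * g%:Z ^+ 2 * b%:Z ^+ (g - 2) <= (2 * s%:Z) ^+ g.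
Proof.
rewrite sgE; case/and3P: reg => _ h _; move: h; rewrite -lez_nat.
by rewrite !PoszM !Posz_exp.
Qed.

Lemma region_sg_le : k%:Z ^+ 2 * (2 * s%:Z) ^+ g <= b%:Z ^+ g.
Proof. by rewrite sgE -!Posz_exp -PoszM lez_nat; case/and3P: reg. Qed.

Lemma region_s_gt0 : (0 < s)%N.
Proof.
have := region_sg_gt0 g_gt1 b_gt0 region_sg_ge.
by case: s => // ; rewrite mulr0 expr0n gtn_eqF// ltnW.
Qed.

Lemma region_disc_ge : 3 * (b%:Z * (2 * s%:Z)) ^+ g <= disc_form g b%:Z k%:Z s%:Z.
Proof.
have := region_trace g_gt1 b_gt0 (le0z_nat k) region_sg_ge region_sg_le.
rewrite disc_form_trace2 [(b%:Z * _) ^+ g]exprMn -/(trace2 g b k s).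
by move: (b%:Z ^+ g * _) (trace2 g b k s ^+ 2) => z y h; rewrite lerBrDr -lerBrDl (_ : 4 * z - 3 * z = z)//; ring.
Qed.

Lemma region_disc_le : disc_form g b%:Z k%:Z s%:Z <= 4 * (b%:Z * (2 * s%:Z)) ^+ g.
Proof. by rewrite disc_form_trace2 gerBl sqr_ge0. Qed.

Lemma region_disc_gt0 : 0 < disc_form g b%:Z k%:Z s%:Z.
Proof.
apply: lt_le_trans region_disc_ge; rewrite mulr_gt0// exprn_gt0// !mulr_gt0//.
by rewrite ltz_nat region_s_gt0.
Qed.

Lemma region_discE : `|disc_form g b%:Z k%:Z s%:Z|%N%:Z = disc_form g b%:Z k%:Z s%:Z.
Proof. by rewrite gez0_abs// ltW// region_disc_gt0. Qed.

Hypothesis sqf : squarefree `|disc_form g b%:Z k%:Z s%:Z|%N.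

(** For [k = 0] one has [Q = g b^(g-1)], and [b^2] divides both terms of the form. *)
Lemma region_k_gt0 : (0 < k)%N.
Proof.
rewrite lt0n; apply/negP => /eqP k0.
suff b1 : b = 1%N by move: b_gt; rewrite b1 ltnNge expn_gt0.
apply: (squarefree_sqr_dvd sqf); rewrite k0.
have Q : pow_quot g b%:Z 0 = g%:Z * b%:Z ^+ g.-1.
  transitivity (\sum_(i < g) b%:Z ^+ g.-1); last by rewrite sumr_const card_ord -mulr_natl natz.
  rewrite /pow_quot addr0.
  by apply: eq_bigr => -[i ig] _ /=; rewrite -exprD subnK//; clear -ig; lia.
suff : ((b ^ 2)%N %| disc_form g b%:Z 0 s%:Z)%Z by rewrite dvdzE.
rewrite /disc_form Q mul0r sub0r sqrrN Posz_exp.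
rewrite [(g%:Z * _) ^+ 2]exprMn -exprM rpredB//.
  by rewrite -mulrA mulrCA dvdz_mulr// dvdz_exp2l.
by rewrite dvdz_mull// dvdz_exp2l//; clear -g_gt1; lia.
Qed.

Lemma region_embeds :
  (1 < `|disc_form g b%:Z k%:Z s%:Z|)%N /\
  embeds_in_Cl ('Z_g * 'Z_g)%type `|disc_form g b%:Z k%:Z s%:Z|%N.
Proof.
have s0 := region_s_gt0; have k0 := region_k_gt0.
have dge := region_disc_ge; rewrite -region_discE in dge.
have z2E : (b * (2 * s))%N%:Z = b%:Z * (2 * s%:Z) by rewrite !PoszM.
have z1E : ((b + k) * (2 * s))%N%:Z = (b%:Z + k%:Z) * (2 * s%:Z) by rewrite !PoszM PoszD.
have z2big : (2 ^ g < b * (2 * s))%N.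
  by apply: leq_trans b_gt _; rewrite leq_pmulr// muln_gt0 s0.
have dge' : (3 * (b * (2 * s)) ^ g <= `|disc_form g b%:Z k%:Z s%:Z|)%N.
  by rewrite -lez_nat PoszM Posz_exp z2E.
split.
  apply: leq_trans dge'; apply: (@leq_trans (3 * 1)%N) => //.
  by rewrite leq_mul2l expn_gt0 muln_gt0 muln_gt0 s0 (leq_ltn_trans _ b_gt).
(* The last argument is [E]: the traces add up to [2 k (2 s)^g], and the square of [2 s] supplies
   the missing factor 4 of [8 E]. *)
apply: (@two_powers_embed g _ ((b + k) * (2 * s))%N (b * (2 * s))%N
   (k%:Z * (2 * s%:Z) ^+ g + pow_quot g b%:Z k%:Z) (trace2 g b k s)
   (k%:Z * (s%:Z ^+ 2 * (2 * s%:Z) ^+ (g - 2)))) => //.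
- rewrite region_discE z1E disc_form_trace2 [(b%:Z * _) ^+ g]exprMn [((b%:Z + _) * _) ^+ g]exprMn.
  have h := pow_quotE g b%:Z k%:Z; rewrite /trace2.
  have -> : (b%:Z + k%:Z) ^+ g = b%:Z ^+ g + k%:Z * pow_quot g b%:Z k%:Z by rewrite h [RHS]addrC subrK.
  by ring.
- by rewrite region_discE z2E disc_form_trace2 subrK.
- by rewrite ltn_pmul2r ?muln_gt0 ?s0// -[X in (X < _)%N]addn0 ltn_add2l.
- rewrite (expnMn (b + k)) (expnMn b) mulnA leq_mul2r; apply/orP; right.
  rewrite -lez_nat PoszM !Posz_exp PoszD.
  exact: (region_pow g_gt1 b_gt0 (le0z_nat k) region_sg_ge region_sg_le (leqnn g)).
- have sE : (2 * s%:Z) ^+ g = (2 * s%:Z) ^+ 2 * (2 * s%:Z) ^+ (g - 2) by rewrite -exprD subnKC.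
  by rewrite /trace2 sE; ring.
Qed.

End RegionNat.

Lemma trace2_inj g (b k k' s : nat) : (1 < g)%N ->
  in_region g b k s -> in_region g b k' s -> trace2 g b k s = trace2 g b k' s -> k = k'.
Proof.
move=> g1; wlog kk : k k' / (k < k')%N.
  move=> H r r' e; case: (ltngtP k k') => // h; first exact: H h r r' e.
  by apply/esym; exact: H h r' r (esym e).
move=> r r' /eqP; rewrite lt_eqF//.
have b0 : 0 < b%:Z by case/and3P: r => h _ _; rewrite ltz_nat (leq_ltn_trans _ h).
exact: (region_trace_inj g1 b0 _ _ (region_sg_ge r) (region_sg_le r')).
Qed.

(** * Counting *)

Lemma absz_sub_inj (a b c d : int) : `|a - b|%N = `|c - d|%N -> (a <= b) = (c <= d) ->
  a - b = c - d.
Proof. by case: (lerP a b) => h; case: (lerP c d) => h' //; lia. Qed.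

Lemma add_sub_inj (a b c d : int) : a - b = c - d -> a + b = c + d -> a = c /\ b = d.
Proof. by move=> h h'; split; lia. Qed.

Lemma sqr_sign_inj (a b c : int) : (a - b) * (a + b) = 0 -> (a - c) * (a + c) = 0 ->
  (a == b) = (a == c) -> b = c.
Proof.
move=> /eqP + /eqP; rewrite !mulf_eq0 !subr_eq0 !addr_eq0.
by case: eqP => [<- _ _ /esym/eqP//|_ /eqP h1]; case: eqP => //= _ /eqP h2 _; lia.
Qed.

Section PairCount.
Variables (g Y K S Dm : nat).
Hypothesis g_gt1 : (1 < g)%N.
Hypothesis divD : forall n, (0 < n)%N -> (n <= 4 * (Y * (2 * S)) ^ g)%N -> (size (divisors n) <= Dm)%N.

Let T := ('I_Y.+1 * 'I_K.+1 * 'I_S.+1)%type.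
Let reg (t : T) := in_region g t.1.1 t.1.2 t.2.
Let D (t : T) : int := disc_form g (t.1.1 : nat)%:Z (t.1.2 : nat)%:Z (t.2 : nat)%:Z.
Let X (t : T) : int := trace2 g t.1.1 t.1.2 t.2.
Let z (t : T) : nat := (t.1.1 * (2 * t.2))%N.
Let N (u : T * T) : int := 4 * ((z u.1)%:Z ^+ g - (z u.2)%:Z ^+ g).

Let DE t : D t = 4 * (z t)%:Z ^+ g - X t ^+ 2.
Proof. by rewrite /D disc_form_trace2 /z !PoszM. Qed.

Let zle t : (z t <= Y * (2 * S))%N.
Proof. by apply: leq_mul; rewrite ?leq_mul2l -ltnS ltn_ord. Qed.

Let E := [set u : T * T | [&& reg u.1, reg u.2 & D u.1 == D u.2]].

Let factor u : u \in E -> (X u.1 - X u.2) * (X u.1 + X u.2) = N u.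
Proof.
rewrite inE => /and3P[_ _ /eqP]; rewrite !DE => h.
by rewrite -subr_sqr /N; move: h; move: (_ ^+ g) (_ ^+ g) (_ ^+ 2) (_ ^+ 2) => a b c d; lra.
Qed.

Let N_neq0 u : z u.1 != z u.2 -> N u != 0.
Proof.
move=> zz; rewrite mulf_neq0// subr_eq0 eqrXn2// ?eqz_nat// ltnW//.
Qed.

Let N_le u : (`|N u| <= 4 * (Y * (2 * S)) ^ g)%N.
Proof.
rewrite /N abszM /= leq_mul2l /=; rewrite -!Posz_exp.
have h t : (z t ^ g <= (Y * (2 * S)) ^ g)%N by rewrite leq_expn_base.
by have := h u.1; have := h u.2; lia.
Qed.

Let E1 := [set u in E | z u.1 != z u.2].
Let E2 := [set u in E | z u.1 == z u.2].

(** A pair is encoded by [b], [s], [b'], [s'], the order of the two traces and the index of the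
    absolute value of their difference among the divisors of [N]. As [N] is not 0, this gives back
    both traces, and then [k] and [k']. *)
Lemma pair_count_off : (#|E1| <= (Y.+1 * S.+1) ^ 2 * (2 * Dm.+1))%N.
Proof.
pose e (u : T * T) : 'I_Dm.+1 := inord (index `|X u.1 - X u.2|%N (divisors `|N u|)).
pose phi (u : T * T) := ((u.1.1.1, u.1.2, (u.2.1.1, u.2.2)), (X u.1 <= X u.2, e u)).
have phi_inj : {in E1 &, injective phi}.
  move=> u v; rewrite !inE => /andP[uE uz] /andP[vE vz] [eb es eb' es' esg ee].
  have uE' : u \in E by rewrite inE. have vE' : v \in E by rewrite inE.
  have zu : z u.1 = z v.1 by rewrite /z eb es.
  have zu' : z u.2 = z v.2 by rewrite /z eb' es'.
  have NE : N u = N v by rewrite /N zu zu'.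
  have fu := factor uE'; have fv := factor vE'.
  have N0 := N_neq0 uz.
  have divs w : w \in E -> N w != 0 -> `|X w.1 - X w.2|%N \in divisors `|N w|.
    move=> wE w0; rewrite -dvdn_divisors ?absz_gt0//.
    by rewrite -(factor wE) abszM dvdn_mulr.
  have ltD w : w \in E -> N w != 0 -> (index `|X w.1 - X w.2|%N (divisors `|N w|) < Dm.+1)%N.
    move=> wE w0; rewrite ltnS; apply: leq_trans (index_size _ _) _.
    by apply: divD; rewrite ?absz_gt0// N_le.
  have N0v : N v != 0 by rewrite -NE.
  have ab : `|X u.1 - X u.2|%N = `|X v.1 - X v.2|%N.
    move: ee; rewrite /e => /(congr1 val); rewrite /= !inordK ?ltD// NE => ii.
    have := nth_index 0%N (divs _ vE' N0v); rewrite -ii nth_index// -NE.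
    exact: divs.
  have xx : X u.1 - X u.2 = X v.1 - X v.2 by exact: absz_sub_inj.
  have x0 : X u.1 - X u.2 != 0.
    by apply: contraNneq N0 => h; rewrite -fu h mul0r.
  have yy : X u.1 + X u.2 = X v.1 + X v.2.
    by apply: (mulfI x0); rewrite fu NE -fv xx.
  have [x1 x2] := add_sub_inj xx yy.
  move: uE vE x1 x2 eb es eb' es'; case: u v {uz vz ee esg uE' vE' zu zu' NE fu fv N0 N0v ab xx x0 yy}
    => [[[b k] s] [[b' k'] s']] [[[c l] t] [[c' l'] t']].
  rewrite /reg /X /= => /and3P[r1 r2 _] /and3P[q1 q2 _] + + ? ? ? ?; subst c t c' t'.
  move=> /(trace2_inj g_gt1 r1 q1)/val_inj -> /(trace2_inj g_gt1 r2 q2)/val_inj ->.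
  by [].
rewrite -(card_in_imset phi_inj); apply: leq_trans (max_card _) _.
by rewrite !card_prod card_bool !card_ord mulnn.
Qed.

(** Here [N = 0], so the traces agree up to sign. The first triple, [s'] and the sign determine [b']
    through [z], and [k'] through the trace. *)
Lemma pair_count_diag : (#|E2| <= Y.+1 * K.+1 * S.+1 * (S.+1 * 2))%N.
Proof.
pose phi (u : T * T) := (u.1, (u.2.2, X u.1 == X u.2)).
have phi_inj : {in E2 &, injective phi}.
  move=> [u u'] [v v']; rewrite !inE /= => /andP[uE /eqP uz] /andP[vE /eqP vz] [e es ex].
  subst v.
  have uE' : (u, u') \in E by rewrite inE. have vE' : (u, v') \in E by rewrite inE.
  have fu := factor uE'; have fv := factor vE'.
  rewrite /N /= uz subrr mulr0 in fu; rewrite /N /= vz subrr mulr0 in fv.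
  have xx : X u' = X v' by exact: (sqr_sign_inj fu fv ex).
  have zz : z u' = z v' by rewrite -uz -vz.
  move: uE vE xx zz es; case: u' v' {uz vz uE' vE' fu fv ex} => [[b k] s] [[c l] t].
  rewrite /reg /X /z /= => /and3P[_ r1 _] /and3P[_ r2 _] xx zz ?; subst t.
  have s0 := region_s_gt0 g_gt1 r1.
  have bc : b = c.
    by apply: val_inj; apply/eqP; rewrite -(@eqn_pmul2r (2 * s)) ?muln_gt0//; apply/eqP.
  subst c; have /val_inj -> // := trace2_inj g_gt1 r1 r2 xx.
rewrite -(card_in_imset phi_inj); apply: leq_trans (max_card _) _.
by rewrite !card_prod card_bool !card_ord.
Qed.

Lemma pair_count : (#|E| <= (Y.+1 * S.+1) ^ 2 * (2 * Dm.+1) + Y.+1 * K.+1 * S.+1 * (S.+1 * 2))%N.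
Proof.
apply: leq_trans (leq_add pair_count_off pair_count_diag).
apply: leq_trans (leq_card_setU _ _); apply/subset_leq_card/fintype.subsetP => u uE.
by rewrite !inE in uE *; rewrite uE; case: eqP.
Qed.

End PairCount.

(** * Square-free values in a box away from the axes *)

Definition box3 (R : realType) (Y K S : nat) (j : 'I_3) : R := (nth 0%N [:: Y; K; S] j)%:R.

Definition disc3 (g Y K S : nat) (t : 'I_Y.+1 * 'I_K.+1 * 'I_S.+1) : int :=
  disc_form g (t.1.1 : nat)%:Z (t.1.2 : nat)%:Z (t.2 : nat)%:Z.

Lemma sqf_count_le (R : realType) (g Y K S : nat) :
  (sqf_count (disc_mpoly g) (box3 R Y K S) <=
    #|[pred t : 'I_Y.+1 * 'I_K.+1 * 'I_S.+1 | squarefree `|disc3 g t|]|)%N.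
Proof.
set A := (X in (#|X| <= _)%N).
pose h (x : {dffun forall j : 'I_3, 'I_(Num.truncn (box3 R Y K S j)).+1}) :
    'I_Y.+1 * 'I_K.+1 * 'I_S.+1 :=
  (inord (x (@Ordinal 3 0 isT)), inord (x (@Ordinal 3 1 isT)), inord (x (@Ordinal 3 2 isT))).
have lt (x : {dffun forall j : 'I_3, 'I_(Num.truncn (box3 R Y K S j)).+1}) (j : 'I_3) :
    (x j < (nth 0%N [:: Y; K; S] j).+1)%N.
  by apply: leq_trans (ltn_ord (x j)) _; rewrite /box3 natrK.
have lt0 x := lt x (@Ordinal 3 0 isT).
have lt1 x := lt x (@Ordinal 3 1 isT).
have lt2 x := lt x (@Ordinal 3 2 isT).
have hinj : injective h.
  move=> x y [/(congr1 val) + /(congr1 val) + /(congr1 val)].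
  rewrite /= !inordK// => e0 e1 e2; apply/ffunP => -[[|[|[|//]]] ltj].
  - by rewrite (_ : Ordinal ltj = @Ordinal 3 0 isT); [exact: val_inj|exact: val_inj].
  - by rewrite (_ : Ordinal ltj = @Ordinal 3 1 isT); [exact: val_inj|exact: val_inj].
  - by rewrite (_ : Ordinal ltj = @Ordinal 3 2 isT); [exact: val_inj|exact: val_inj].
rewrite -(card_imset _ hinj); apply/subset_leq_card/fintype.subsetP => _ /imsetP[x xA ->].
by move: xA; rewrite !inE meval_disc_mpoly /disc3 /h /= !inordK.
Qed.

Lemma sqf_count_ge (R : realType) (g Y K S y s : nat) :
  (#|[pred t : 'I_Y.+1 * 'I_K.+1 * 'I_S.+1 |
      [&& squarefree `|disc3 g t|, (t.1.1 <= y)%N & (t.2 <= s)%N]]| <=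
   sqf_count (disc_mpoly g) (box3 R y K s))%N.
Proof.
set A := (X in (#|X| <= _)%N).
pose h (t : 'I_Y.+1 * 'I_K.+1 * 'I_S.+1) :
    {dffun forall j : 'I_3, 'I_(Num.truncn (box3 R y K s j)).+1} :=
  [ffun j : 'I_3 => (inord (nth 0%N [:: (t.1.1 : nat); (t.1.2 : nat); (t.2 : nat)] j)
    : 'I_(Num.truncn (box3 R y K s j)).+1)].
have hE t (j : 'I_3) : t \in A ->
    h t j = nth 0%N [:: (t.1.1 : nat); (t.1.2 : nat); (t.2 : nat)] j :> nat.
  rewrite !inE => /and3P[_ ty ts]; rewrite ffunE inordK// /box3 natrK.
  case: j => -[|[|[|//]]] lt /=; by rewrite ltnS// -ltnS.
have hinj : {in A &, injective h}.
  move=> t u tA uA e.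
  have e' j := congr1 (fun f : {dffun forall j : 'I_3, 'I_(Num.truncn (box3 R y K s j)).+1} => (f j : nat)) e.
  have := e' (@Ordinal 3 0 isT); have := e' (@Ordinal 3 1 isT); have := e' (@Ordinal 3 2 isT).
  rewrite /= !hE//=; case: t u {tA uA e e'} => [[b k] z] [[b' k'] z'] /=.
  by move=> /val_inj -> /val_inj -> /val_inj ->.
rewrite -(card_in_imset hinj); apply/subset_leq_card/fintype.subsetP => _ /imsetP[t tA ->].
have := tA; rewrite !inE => /and3P[sq _ _]; rewrite meval_disc_mpoly.
by rewrite !hE.
Qed.

(** The conjecture counts in boxes with a corner at 0, so the slices with small [b] or small [s] are
    subtracted. Each has a quarter of the volume, and with relative error 1/6 there remains
    [5/6 - 2 * (1/4) * (7/6) = 1/4] of the main term. *)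
Lemma box_count (R : realType) (g : nat) : (1 < g)%N -> sqf_values_conjecture R ->
  exists2 c : R, 0 < c & exists M : nat, forall y K s : nat,
    (M < y)%N -> (M < K)%N -> (M < s)%N ->
    c * ((4 * y)%:R * K%:R * (4 * s)%:R) <=
    #|[set t : 'I_(4 * y).+1 * 'I_K.+1 * 'I_(4 * s).+1 |
        [&& squarefree `|disc3 g t|, (y < t.1.1)%N & (s < t.2)%N]]|%:R.
Proof.
move=> g1 hconj; have C0 := sqf_constant_disc_gt0 R g1.
set C := sqf_constant R (disc_mpoly g) in C0.
have [|M MP] := hconj 3 (disc_mpoly g) (msize_disc_mpoly g1) (lt0r_neq0 C0) (6^-1).
  by rewrite invr_gt0.
exists (C / 4); first by rewrite divr_gt0.
exists (Num.truncn (`|M|)).+1 => y K s yM KM sM.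
have cnt Y' K' S' : (Num.truncn (`|M|) < Y')%N -> (Num.truncn (`|M|) < K')%N -> (Num.truncn (`|M|) < S')%N ->
    C * (Y'%:R * K'%:R * S'%:R) * (5 / 6) <= (sqf_count (disc_mpoly g) (box3 R Y' K' S'))%:R
      <= C * (Y'%:R * K'%:R * S'%:R) * (7 / 6).
  move=> hY hK hS.
  have big n : (Num.truncn (`|M|) < n)%N -> 1 <= n%:R :> R /\ M <= n%:R.
    move=> hn; split; first by rewrite ler1n (leq_ltn_trans _ hn).
    apply: le_trans (ler_norm M) _; apply/ltW; apply: lt_le_trans (truncnS_gt _) _.
    by rewrite ler_nat.
  have bx (j : 'I_3) : 1 <= box3 R Y' K' S' j /\ M <= box3 R Y' K' S' j.
    by case: j => -[|[|[|//]]] lt; rewrite /box3 /=; exact: big.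
  have pr : \prod_j box3 R Y' K' S' j = Y'%:R * K'%:R * S'%:R.
    by rewrite !big_ord_recl big_ord0 mulr1 mulrA.
  have := MP (box3 R Y' K' S') (fun j => (bx j).1) (fun j => (bx j).2).
  rewrite pr -/C; set V := Y'%:R * K'%:R * S'%:R.
  have V0 : 0 < C * V.
    by rewrite mulr_gt0// !mulr_gt0// ltr0n (leq_ltn_trans _ hY, leq_ltn_trans _ hK, leq_ltn_trans _ hS).
  rewrite ltr_distl => /andP[/ltW h1 /ltW h2].
  rewrite ler_pdivlMr// in h1; rewrite ler_pdivrMr// in h2.
  by move: h1 h2; move: (C * V) => v h1 h2; apply/andP; split; lra.
set T := ('I_(4 * y).+1 * 'I_K.+1 * 'I_(4 * s).+1)%type.
set G := [set t | _].
have dec : (#|[pred t : T | squarefree `|disc3 g t|]| <=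
  #|G| + (#|[pred t : T | [&& squarefree `|disc3 g t|, (t.1.1 <= y)%N & (t.2 <= 4 * s)%N]]| +
  #|[pred t : T | [&& squarefree `|disc3 g t|, (t.1.1 <= 4 * y)%N & (t.2 <= s)%N]]|))%N.
  set A1 := [pred t : T | [&& _, (t.1.1 <= y)%N & _]]; set A2 := [pred t : T | [&& _, _ & (t.2 <= s)%N]].
  apply: leq_trans (_ : #|G :|: ([set t in A1] :|: [set t in A2])| <= _)%N.
    apply/subset_leq_card/fintype.subsetP => t; rewrite !inE => ->.
    have -> : (t.1.1 <= 4 * y)%N by rewrite -ltnS.
    have -> : (t.2 <= 4 * s)%N by rewrite -ltnS.
    by rewrite !ltnNge; case: (_ <= y)%N; case: (_ <= s)%N.
  apply: leq_trans (leq_card_setU _ _) _; rewrite leq_add2l.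
  by apply: leq_trans (leq_card_setU _ _) _; rewrite !cardsE.
have d1 := leq_trans (sqf_count_le R g (4 * y) K (4 * s)) dec.
have d2 := sqf_count_ge R g (4 * y) K (4 * s) y (4 * s).
have d3 := sqf_count_ge R g (4 * y) K (4 * s) (4 * y) s.
have d4 : (sqf_count (disc_mpoly g) (box3 R (4 * y) K (4 * s)) <= #|G| +
   (sqf_count (disc_mpoly g) (box3 R y K (4 * s)) + sqf_count (disc_mpoly g) (box3 R (4 * y) K s)))%N.
  by apply: leq_trans d1 _; rewrite leq_add2l leq_add.
have y4 : (Num.truncn `|M| < 4 * y)%N by clear -yM; lia.
have s4 : (Num.truncn `|M| < 4 * s)%N by clear -sM; lia.
have /andP[c1 _] := cnt _ _ _ y4 (ltnW KM) s4.
have /andP[_ c2] := cnt _ _ _ (ltnW yM) (ltnW KM) s4.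
have /andP[_ c3] := cnt _ _ _ y4 (ltnW KM) (ltnW sM).
move: d4; rewrite -(ler_nat R) !natrD => d4.
by move: c1 c2 c3 d4; rewrite !natrM; lra.
Qed.

(* [4 * box_b g t] is [(32 g t) ^ g]; the constants are chosen for [box_in_region]. *)
Definition box_b (g t : nat) : nat := (8 * g * t * (32 * g * t) ^ g.-1)%N.
Definition box_k (g t : nat) : nat := (t ^ g)%N.
Definition box_s (g t : nat) : nat := (g * (32 * g * t) ^ (g - 2))%N.
Definition disc_max (g t : nat) : nat := (4 * (4 * box_b g t * (2 * (4 * box_s g t))) ^ g)%N.

Lemma box_b4 (g t : nat) : (0 < g)%N ->
  (4 * (8 * g * t * (32 * g * t) ^ g.-1) = (32 * g * t) ^ g)%N.
Proof. by case: g => // g _; rewrite expnS !mulnA. Qed.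

(** Let [W = 32 g t]. The second condition follows from [b <= W^g] and [s >= g W^(g-2)]. The third
    one, multiplied by [4^g], reduces to [32 g t^2 <= W^2] through [4 b >= W^g] and
    [s <= 4 g W^(g-2)]. *)
Lemma box_in_region (g t b k s : nat) : (1 < g)%N -> (0 < t)%N ->
  (box_b g t < b)%N -> (b <= 4 * box_b g t)%N -> (k <= box_k g t)%N ->
  (box_s g t < s)%N -> (s <= 4 * box_s g t)%N -> in_region g b k s.
Proof.
move=> g1 t0; rewrite /box_b /box_k /box_s.
have W0 : (0 < 32 * g * t)%N by rewrite !muln_gt0 t0 (ltnW g1).
rewrite box_b4 ?(ltnW g1)//.
have b4 : (8 * g * t * (32 * g * t) ^ g.-1 * 4 = (32 * g * t) ^ g)%N.
  by rewrite mulnC box_b4// ltnW.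
move=> hb1 hb2 hk hs1 hs2.
have hb3 : ((32 * g * t) ^ g <= 4 * b)%N by rewrite -b4 mulnC leq_mul2l ltnW.
apply/and3P; split.
- apply: leq_ltn_trans hb1.
  rewrite -(@leq_pmul2r 4)// b4.
  apply: (@leq_trans (8 ^ g)%N); last first.
    by rewrite leq_expn_base// -mulnA; apply: (@leq_trans (32 * 1)%N) => //; rewrite leq_mul2l muln_gt0 t0 (ltnW g1).
  rewrite (_ : 8 = 2 * 4)%N// expnMn leq_mul2l -{1}(expn1 4) leq_pexp2l ?orbT//; exact: ltnW.
- apply: (@leq_trans ((2 * g) ^ 2 * (32 * g * t) ^ (g * (g - 2)))%N).
    rewrite expnMn leq_mul2l; apply/orP; right.
    by rewrite expnM leq_expn_base.
  apply: (@leq_trans ((2 * (g * (32 * g * t) ^ (g - 2))) ^ g)%N).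
    rewrite [(2 * (g * _))%N]mulnA (expnMn (2 * g)) -expnM [((g - 2) * g)%N]mulnC.
    rewrite leq_mul2r leq_pexp2l ?orbT//.
    by rewrite muln_gt0 (ltnW g1).
  by rewrite leq_expn_base// leq_mul2l ltnW.
- rewrite -(@leq_pmul2r (4 ^ g)) ?expn_gt0// -expnMn [(b * 4)%N]mulnC.
  apply: leq_trans (leq_expn_base _ hb3).
  apply: (@leq_trans ((t ^ g) ^ 2 * (2 * (4 * (g * (32 * g * t) ^ (g - 2)))) ^ g * 4 ^ g)%N).
    by rewrite leq_mul2r; apply/orP; right; apply: leq_mul; apply: leq_expn_base; rewrite ?leq_mul2l.
  rewrite -mulnA -expnMn.
  rewrite (_ : 2 * (4 * (g * (32 * g * t) ^ (g - 2))) * 4 = 32 * g * (32 * g * t) ^ (g - 2))%N; last by ring.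
  rewrite expnAC -expnMn leq_expn_base//.
  rewrite -[X in (_ <= _ ^ X)%N](subnKC g1) expnD mulnA leq_mul2r; apply/orP; right.
  rewrite expnMn mulnC leq_mul2r -{1}(expn1 (32 * g)) leq_pexp2l ?orbT//.
  by rewrite muln_gt0 (ltnW g1).
Qed.

Lemma disc_maxE (g t : nat) : (1 < g)%N ->
  disc_max g t = (4 * (8 * g) ^ g * (32 * g) ^ (2 * g * g.-1) * t ^ (2 * g * g.-1))%N.
Proof.
move=> g1; rewrite /disc_max /box_b /box_s.
rewrite box_b4 ?(ltnW g1)//.
rewrite -[RHS]mulnA -expnMn -[RHS]mulnA; congr (_ * _)%N.
rewrite (_ : 2 * (4 * (g * _)) = 8 * g * (32 * g * t) ^ (g - 2))%N; last by ring.
rewrite mulnCA -expnD expnMn -expnM; congr (_ * (_ ^ _))%N.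
by clear -g1; nia.
Qed.

Definition divisor_max (n : nat) : nat := \max_(m < n.+1 | (0 < m)%N) size (divisors m).

Lemma size_divisors_max (n m : nat) : (0 < m)%N -> (m <= n)%N -> (size (divisors m) <= divisor_max n)%N.
Proof.
move=> m0 mn; rewrite -ltnS in mn.
exact: (@leq_bigmax_cond _ _ (fun i : 'I_n.+1 => size (divisors i)) (Ordinal mn)).
Qed.

Lemma divisor_max_gt0 n : (0 < n)%N -> (0 < divisor_max n)%N.
Proof. by move=> n0; apply: leq_trans (size_divisors_max (ltnSn 0) n0). Qed.

Lemma divisor_max_le (C q n : nat) : (0 < q)%N -> (forall m, (0 < m)%N -> (size (divisors m) ^ q <= C * m)%N) ->
  (divisor_max n ^ q <= C * n)%N.
Proof.
move=> q0 h; rewrite /divisor_max; elim/big_ind: _ => [|x y hx hy|i i0].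
- by rewrite exp0n.
- by rewrite /maxn; case: ifP.
- by apply: leq_trans (h _ i0) _; rewrite leq_mul2l -ltnS ltn_ord orbT.
Qed.

(** The square of the number of triples has order at least [(y K s)^2] and the colliding pairs
    number at most [96 Dm (4 y * 4 s)^2]; the quotient leaves [K^2 = t^(2g)]. *)
Lemma N_H_lower (R : realType) (g : nat) : (2 < g)%N -> sqf_values_conjecture R ->
  exists2 c : R, 0 < c & exists M : nat, forall (t : nat) (X : R), (M < t)%N ->
    (disc_max g t)%:R <= X ->
    c * t%:R ^+ (2 * g) <= (N_H ('Z_g * 'Z_g)%type X)%:R * (divisor_max (disc_max g t))%:R.
Proof.
move=> g2 hconj; have g1 := ltnW g2; have [c c0 [M cM]] := box_count g1 hconj.
exists (c ^+ 2 / 96); first by rewrite divr_gt0// exprn_gt0.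
exists M => t X Mt tX.
have t0 : (0 < t)%N by exact: leq_ltn_trans Mt.
set y := box_b g t; set K := box_k g t; set s := box_s g t; set Dm := divisor_max _.
have W0 : (0 < 32 * g * t)%N by rewrite !muln_gt0 t0 (ltnW g1).
have tW n : (0 < n)%N -> (t ^ n <= (32 * g * t) ^ n)%N.
  by move=> n0; rewrite leq_exp2r// leq_pmull// muln_gt0 (ltnW g1).
have Ky : (K <= y)%N.
  rewrite /K /box_k /y /box_b -{1}(prednK (ltnW g1)) expnS.
  apply: leq_mul; last by rewrite tW// -ltnS prednK// ltnW.
  by rewrite leq_pmull// muln_gt0 (ltnW g1).
have tK : (t <= K)%N by rewrite -{1}(expn1 t) leq_pexp2l// ltnW.
have ty : (t <= y)%N by exact: leq_trans Ky.
(* The side [s] grows like [t^(g-2)]; the conjecture needs it to tend to infinity, whence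
   [2 < g]. *)
have ts : (M < s)%N.
  apply: leq_trans Mt _; rewrite /s /box_s; apply: (@leq_trans (t ^ (g - 2))).
    by rewrite -{1}(expn1 t) leq_pexp2l// subn_gt0.
  by apply: leq_trans (tW _ _) (leq_pmull _ (ltnW g1)); rewrite subn_gt0.
have Gc := cM y K s (leq_trans Mt ty) (leq_trans Mt tK) ts.
set G := [set u | _] in Gc.
have Greg u : u \in G -> in_region g u.1.1 u.1.2 u.2.
  rewrite inE => /and3P[_ h1 h2].
  by apply: (box_in_region g1 t0) => //; rewrite -ltnS ltn_ord.
have Gle u : u \in G -> (`|disc3 g u| <= disc_max g t)%N.
  move=> uG; have := region_disc_le g u.1.1 u.1.2 u.2.
  rewrite -(region_discE g1 (Greg _ uG)) -[2]/(2%:Z) -!PoszM -Posz_exp -PoszM lez_nat => h.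
  apply: leq_trans h _; rewrite leq_mul2l /= leq_expn_base//.
  by apply: leq_mul; rewrite ?leq_mul2l -ltnS ltn_ord.
pose n := Num.truncn X.
have tn : (disc_max g t <= n)%N by rewrite truncn_ge_nat// (le_trans _ tX).
pose f (u : 'I_(4 * y).+1 * 'I_K.+1 * 'I_(4 * s).+1) : 'I_n.+1 := inord `|disc3 g u|.
have fE u : u \in G -> f u = `|disc3 g u|%N :> nat.
  by move=> uG; rewrite inordK// ltnS (leq_trans (Gle _ uG)).
have ND : (#|f @: G| <= N_H ('Z_g * 'Z_g)%type X)%N.
  apply/subset_leq_card/fintype.subsetP => _ /imsetP[u uG ->].
  have := uG; rewrite !inE => /and3P[sq _ _].
  rewrite (fE _ uG) sq /=; have [-> em] := region_embeds g1 (Greg _ uG) sq.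
  by apply/asboolP.
have card := card_image_pairs G f.
have Dn m : (0 < m)%N -> (m <= 4 * (4 * y * (2 * (4 * s))) ^ g)%N -> (size (divisors m) <= Dm)%N.
  exact: size_divisors_max.
have pc := @pair_count g (4 * y) K (4 * s) Dm g1 Dn.
have sub : (#|[set v | [&& v.1 \in G, v.2 \in G & f v.1 == f v.2]]| <=
   ((4 * y).+1 * (4 * s).+1) ^ 2 * (2 * Dm.+1) + (4 * y).+1 * K.+1 * (4 * s).+1 * ((4 * s).+1 * 2))%N.
  apply: leq_trans pc; apply/subset_leq_card/fintype.subsetP => -[u v] uv.
  have /and3P[uG vG /eqP fuv] : [&& u \in G, v \in G & f u == f v] by move: uv; rewrite inE.
  rewrite inE /= (Greg _ uG) (Greg _ vG) /=.
  have : `|disc3 g u|%N = `|disc3 g v|%N by rewrite -(fE _ uG) -(fE _ vG) fuv.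
  move/(congr1 Posz); rewrite /disc3 (region_discE g1 (Greg _ uG)) (region_discE g1 (Greg _ vG)).
  by move/eqP.
have y0 : (0 < y)%N by exact: leq_trans ty.
have s0 : (0 < s)%N by exact: leq_ltn_trans ts.
have Dm0 : (0 < Dm)%N.
  have pos (a b : nat) : (0 < a)%N -> (0 < b)%N -> (0 < 4 * (4 * a * (2 * (4 * b))) ^ g)%N.
    by move=> a0 b0; rewrite muln_gt0 expn_gt0 !muln_gt0 a0 b0.
  by apply: divisor_max_gt0; exact: pos.
(* The constant is [96 = 64 + 32]: 64 from the pairs with different [z], and 32 from the diagonal,
   where [K <= y] is used. *)
have fin : (#|G| ^ 2 <= N_H ('Z_g * 'Z_g)%type X * (96 * Dm * (4 * y * (4 * s)) ^ 2))%N.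
  apply: leq_trans card _; apply: leq_mul => //; apply: leq_trans sub _.
  have K0 : (0 < K)%N by exact: leq_trans tK.
  have h1 : ((4 * y).+1 <= 2 * (4 * y))%N by clear -y0; lia.
  have h2 : ((4 * s).+1 <= 2 * (4 * s))%N by clear -s0; lia.
  have h3 : (K.+1 <= 2 * (4 * y))%N by clear -Ky y0; lia.
  have h4 : (2 * Dm.+1 <= 4 * Dm)%N by clear -Dm0; lia.
  apply: (@leq_trans ((2 * (4 * y) * (2 * (4 * s))) ^ 2 * (4 * Dm) +
    2 * (4 * y) * (2 * (4 * y)) * (2 * (4 * s)) * (2 * (4 * s) * 2))%N).
    apply: leq_add.
      by apply: leq_mul => //; apply: leq_expn_base; exact: leq_mul.
    by apply: leq_mul; [apply: leq_mul => //|]; exact: leq_mul.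
  move: (4 * y)%N (4 * s)%N => p q; rewrite -!mulnn; clear -Dm0.
  have -> : (2 * p * (2 * p) * (2 * q) * (2 * q * 2) = 32 * (p * q * (p * q)))%N by ring.
  have -> : (2 * p * (2 * q) * (2 * p * (2 * q)) * (4 * Dm) = 64 * Dm * (p * q * (p * q)))%N by ring.
  by rewrite -mulnDl leq_mul2r; apply/orP; right; lia.
have castR (a m D p q : nat) : (a ^ 2 <= m * (96 * D * (p * q) ^ 2))%N ->
    a%:R ^+ 2 <= m%:R * (96 * D%:R * (p%:R * q%:R) ^+ 2) :> R.
  by rewrite -(ler_nat R) !(natrM, natrX).
move/castR: fin => fin.
have Y0 : 0 < (4 * y)%:R :> R by rewrite ltr0n muln_gt0.
have S0 : 0 < (4 * s)%:R :> R by rewrite ltr0n muln_gt0.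
have lo : (c * ((4 * y)%:R * K%:R * (4 * s)%:R)) ^+ 2 <= (#|G|%:R : R) ^+ 2.
  by rewrite lerXn2r ?nnegrE ?mulr_ge0 ?ler0n// ltW.
move: (le_trans lo fin) Y0 S0; move: ((4 * y)%:R) ((4 * s)%:R) => p q h p0 q0.
have : c ^+ 2 * K%:R ^+ 2 * (p * q) ^+ 2 <=
    96 * ((N_H ('Z_g * 'Z_g)%type X)%:R * Dm%:R) * (p * q) ^+ 2.
  rewrite (_ : c ^+ 2 * K%:R ^+ 2 * (p * q) ^+ 2 = (c * (p * K%:R * q)) ^+ 2); last by ring.
  by apply: le_trans h _; rewrite le_eqVlt; apply/orP; left; apply/eqP; ring.
rewrite ler_pM2r ?exprn_gt0 ?mulr_gt0// => fin2.
rewrite mulrAC ler_pdivrMr// [X in _ <= X]mulrC; apply: le_trans fin2.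
by rewrite /K /box_k natrX -exprM [(g * 2)%N]mulnC.
Qed.

(** * From the parameter [t] to the bound [X] *)

Lemma root_bound (R : realType) (a D b : R) (q : nat) : (0 < q)%N -> 0 <= a -> 0 <= D ->
  0 <= b -> a ^+ q <= D * b -> a <= D `^ (q%:R^-1) * b `^ (q%:R^-1).
Proof.
move=> q0 a0 D0 b0 h; rewrite -powRM//.
have q0' : q%:R != 0 :> R by rewrite pnatr_eq0 -lt0n.
have -> : a = (a ^+ q) `^ (q%:R^-1).
  by rewrite -powR_mulrn// -powRrM mulfV// powRr1.
by apply: ge0_ler_powR; rewrite ?nnegrE ?invr_ge0 ?exprn_ge0 ?mulr_ge0.
Qed.

Theorem theorem3p4 (R : realType) (hconj : sqf_values_conjecture R)
    (g : nat) (hg : (5 <= g)%N) (eps : R) (heps : 0 < eps) :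
  exists2 c : R, 0 < c &
    exists X0 : R, forall X : R, X0 <= X ->
      c * X `^ (1 / (g%:R - 1) - eps) <= (N_H ('Z_g * 'Z_g)%type X)%:R.
Proof.
have g2 : (2 < g)%N by exact: leq_trans hg.
have g1 : (1 < g)%N by exact: ltnW.
have [c0 c0_gt0 [M HM]] := N_H_lower g2 hconj.
(* The divisor bound with exponent [q] loses [1 / q], which must be at most [eps]; moreover [q >= g]
   keeps the exponent [be] nonnegative, so that powers are monotone. *)
pose q := maxn g (Num.truncn eps^-1).+1.
have q_gt0 : (0 < q)%N by rewrite leq_max (ltnW g1).
have [C C_gt0 HC] := divisor_bound q_gt0.
pose m := (2 * g * g.-1)%N.
pose D0 := (4 * (8 * g) ^ g * (32 * g) ^ m)%N.
have g_gt0 : (0 < g)%N by exact: ltnW.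
have D0_gt0 : (0 < D0)%N by rewrite !muln_gt0 !expn_gt0 !muln_gt0 g_gt0.
have m_gt0 : (0 < m)%N by rewrite !muln_gt0 g_gt0 -subn1 subn_gt0.
have dE t : disc_max g t = (D0 * t ^ m)%N by exact: disc_maxE.
clearbody D0.
have gm1 : g%:R - 1 = g.-1%:R :> R by rewrite -{1}(prednK g_gt0) -natr1 addrK.
have p_gt0 : 0 < g.-1%:R :> R by rewrite ltr0n -subn1 subn_gt0.
have mE : m%:R = 2 * g%:R * g.-1%:R :> R by rewrite !natrM.
have q0 : 0 < q%:R :> R by rewrite ltr0n.
have m0 : 0 < m%:R :> R by rewrite ltr0n.
have D0' : 0 < D0%:R :> R by rewrite ltr0n.
have qeps : q%:R^-1 <= eps.
  rewrite -[X in _ <= X]invrK lef_pV2 ?posrE ?invr_gt0//.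
  apply: le_trans (ltW (truncnS_gt _)) _; rewrite ler_nat leq_max leqnn orbT //.
pose be : R := 1 / (g%:R - 1) - q%:R^-1.
have be0 : 0 <= be.
  rewrite /be gm1 div1r subr_ge0 lef_pV2 ?posrE// ler_nat.
  by rewrite (leq_trans (leq_pred g))// leq_maxl.
(* Since [m / (g - 1) = 2 g], the power [be] of [t^m] is [t^(2g)] divided by the divisor loss. *)
have mbe : m%:R * be = (2 * g)%:R - m%:R / q%:R.
  by rewrite /be gm1 natrM mE; field; rewrite !gt_eqF.
pose L : R := (C * D0)%:R `^ (q%:R^-1).
have L0 : 0 < L by rewrite powR_gt0// ltr0n muln_gt0 C_gt0.
pose A : R := (D0%:R * 2 ^+ m) `^ be.
have A0 : 0 < A by rewrite powR_gt0// mulr_gt0// exprn_gt0.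
exists (c0 / L / A); first by rewrite !divr_gt0.
(* The choice [M.+2] makes the integer part [t] of [(X / D0)^(1/m)] exceed [M]. *)
exists (Num.max 1 (D0%:R * M.+2%:R ^+ m)) => X; rewrite ge_max => /andP[X1 XM].
have X0 : 0 < X by exact: lt_le_trans X1.
pose r : R := (X / D0%:R) `^ (m%:R^-1).
have r0 : 0 <= r by exact: powR_ge0.
have rm : r ^+ m = X / D0%:R.
  rewrite -powR_mulrn// -powRrM mulVf ?gt_eqF// powRr1// divr_ge0// ltW//.
have Mr : M.+2%:R <= r.
  rewrite -(@ler_pXn2r _ m) ?nnegrE ?ler0n// rm ler_pdivlMr// mulrC//.
pose t := Num.truncn r.
have /andP[tr rt] : t%:R <= r < t.+1%:R by exact: truncn_itv.
have Mt : (M < t)%N.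
  by rewrite -ltnS -(ltr_nat R); apply: le_lt_trans rt; apply: le_trans Mr; rewrite ler_nat.
have t_gt0 : (0 < t)%N by exact: leq_ltn_trans Mt.
have t0 : 0 < t%:R :> R by rewrite ltr0n.
have dX : (disc_max g t)%:R <= X.
  rewrite dE natrM natrX mulrC -ler_pdivlMr// -rm lerXn2r ?nnegrE ?ler0n//.
have X2 : X <= (D0%:R * 2 ^+ m) * t%:R ^+ m.
  rewrite -mulrA -exprMn mulrC -ler_pdivrMr// -rm lerXn2r ?nnegrE ?mulr_ge0 ?ler0n//.
  by apply: le_trans (ltW rt) _; rewrite -natrM ler_nat; clear -t_gt0; lia.
have main := HM t X Mt dX.
set NN := (N_H _ X)%:R in main *; set Dm := (divisor_max _)%:R in main.
have DmL : Dm <= L * t%:R `^ (m%:R / q%:R).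
  rewrite powRrM powR_mulrn ?ler0n//; apply: root_bound; rewrite ?ler0n ?exprn_ge0 ?ler0n//.
  rewrite -!natrX -natrM ler_nat -mulnA -dE.
  exact: divisor_max_le.
have NN0 : 0 <= NN by exact: ler0n.
have low : c0 * t%:R `^ (m%:R * be) <= NN * L.
  have tq : 0 < t%:R `^ (m%:R / q%:R) :> R by exact: powR_gt0.
  rewrite -(ler_pM2r tq) -mulrA -powRD; last by rewrite (gt_eqF t0) implybT.
  rewrite mbe subrK powR_mulrn ?ler0n//; apply: le_trans main _.
  by rewrite -mulrA ler_wpM2l.
have up : X `^ be <= A * t%:R `^ (m%:R * be).
  rewrite powRrM powR_mulrn ?ler0n// -powRM ?exprn_ge0 ?mulr_ge0 ?ler0n//.
  by apply: ge0_ler_powR; rewrite ?nnegrE ?mulr_ge0 ?exprn_ge0 ?ler0n// ltW.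
have Xe : X `^ (1 / (g%:R - 1) - eps) <= X `^ be.
  by apply: ler_powR => //; rewrite lerD2l lerN2.
rewrite mulrAC ler_pdivrMr// mulrAC ler_pdivrMr//.
apply: (@le_trans _ _ (c0 * (A * t%:R `^ (m%:R * be)))).
  by rewrite ler_pM2l// (le_trans Xe up).
by rewrite mulrCA mulrAC [X in _ <= X]mulrC ler_pM2l.
Qed.
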